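(* Let $d\ge1$, $r\ge 0$, $\mathcal{C}=\mathcal{C}([-r,0],\mathbb{R}^d)$, let $f:\mathbb{R}_+\times\mathcal{C}\to\mathbb{R}^d$, $(t,x)\mapsto f(t,x)$, be a continuous function and let $\phi\in\mathcal{C}$. Suppose that: (H1) $f$ is continuous in the second variable uniformly with respect to the first one, i.e. for every $x\in\mathcal{C}$ and every $\eta>0$ there is $\kappa>0$ such that $|f(t,x')-f(t,x)|<\eta$ for all $t\in\mathbb{R}_+$ and all $x'\in\mathcal{C}$ with $\|x'-x\|<\kappa$; (H2) for every bounded subset $B$ of $\mathcal{C}$, $f$ is bounded on $\mathbb{R}_+\times B$; (H3) for all $x\in\mathcal{C}$ the limit $F(x):=\lim_{T\to\infty}\frac1T\int_0^T f(t,x)\,dt$ exists; (H4) the initial value problem $\dot y(t)=G(y(t))$, $y(0)=\phi(0)$, has a unique solution, where $G:\mathbb{R}^d\to\mathbb{R}^d$ is defined by $G(x)=F(\tilde x)$, with $\tilde x\in\mathcal{C}$ the constant function $\tilde x(\theta)=x$, $\theta\in[-r,0]$. Let $y$ be the solution of the problem in (H4) and let $L\in J$, where $J$ is the positive interval of definition of $y$. Then for every $\delta>0$ there exists $\varepsilon_0=\varepsilon_0(L,\delta)>0$ such that, for all $\varepsilon\in(0,\varepsilon_0]$, every solution $x$ of the initial value problem $$\dot x(t)=f(t/\varepsilon,x_{t,\varepsilon}),\qquad x(t)=\phi(t/\varepsilon)\ \text{ for } t\in[-\varepsilon r,0],$$ is defined at least on $[-\varepsilon r,L]$ and satisfies $|x(t)-y(t)|<\delta$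 for all $t\in[0,L]$.
   Context: $\mathbb{R}_+=[0,\infty)$, $|\cdot|$ is a norm on $\mathbb{R}^d$, and $\mathcal{C}=\mathcal{C}([-r,0],\mathbb{R}^d)$ is the Banach space of continuous functions $[-r,0]\to\mathbb{R}^d$ with norm $\|\phi\|=\sup_{\theta\in[-r,0]}|\phi(\theta)|$ (identified with $\mathbb{R}^d$ when $r=0$). For $t\ge0$ and $\varepsilon>0$, $x_{t,\varepsilon}\in\mathcal{C}$ is given by $x_{t,\varepsilon}(\theta)=x(t+\varepsilon\theta)$, $\theta\in[-r,0]$. A solution of the delay problem is a continuous function on an interval starting at $-\varepsilon r$, with the prescribed values on $[-\varepsilon r,0]$, satisfying the equation for $t\ge0$. Solutions are considered forward in time and are understood to be maximal (non-continuable to the right). ''Unique solution'' means that there is exactly one maximal solution and every solution is a restriction of it; its positive interval of definition $J$ is of the form $[0,\omega)$ with $0<\omega\le\infty$. (Under (H1) and (H3) the functions $F$ and $G$ are continuous.) *)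

(* Defs.v *)
From HB Require Import structures.
From mathcomp Require Import all_boot all_order all_algebra.
From mathcomp Require Import all_classical all_reals all_analysis.
Set Implicit Arguments.
Unset Strict Implicit.
Unset Printing Implicit Defensive.
Import Order.TTheory GRing.Theory Num.Theory.
Import numFieldNormedType.Exports.
Local Open Scope classical_set_scope.
Local Open Scope ring_scope.

(* The library topology of 'rV[R]_d is that of the maximum norm; since all
   norms on R^d are equivalent, limits and continuity in R^d are taken for it,
   while every quantitative statement below uses the given norm N. *)
Record is_norm (R : realType) (d : nat) (N : 'rV[R]_d -> R) : Prop := IsNorm {
  norm_triangle : forall x y, N (x + y) <= N x + N y ;
  norm_scale : forall (a : R) x, N (a *: x) = `|a| * N x ;
  norm_definite : forall x, N x = 0 -> x = 0 }.

Section HistorySpace.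
Context {R : realType} (d : nat) (r : {nonneg R}).

Definition delay_itv : set R := `[- r%:num, 0].

(* C([-r, 0], R^d), with [-r, 0] carrying the subtype topology. *)
Definition history := continuousType delay_itv 'rV[R]_d.

Lemma delay_itv0 : (0 : R) \in delay_itv.
Proof. by rewrite inE /delay_itv /= in_itv /= oppr_le0 ge0 lexx. Qed.

Definition now : delay_itv := exist _ 0 delay_itv0.

Definition const_history (x : 'rV[R]_d) : history := cst x.

Definition supnorm (N : 'rV[R]_d -> R) (g : delay_itv -> 'rV[R]_d) : R :=
  sup [set N (g th) | th in [set: delay_itv]].

(* x_{t,eps} : th |-> x (t + eps * th).  The default value is never used in
   the delay equation, see segmentE. *)
Definition segment (x : R -> 'rV[R]_d) (t eps : R) : history :=
  if pselect (continuous (fun th : delay_itv => x (t + eps * val th)))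
    is left cx then mkcts cx else const_history 0.

Lemma segmentE (x : R -> 'rV[R]_d) (t eps : R) (D : set R) : 0 < eps ->
  {within D, continuous x} -> `[t - eps * r%:num, t] `<=` D ->
  forall th : delay_itv, segment x t eps th = x (t + eps * val th).
Proof.
move=> eps0 xc sD th; rewrite /segment; case: pselect => // ncx; exfalso.
apply: ncx => s.
have inD (u : delay_itv) : D (t + eps * val u).
  apply: sD => /=; have := set_valP u; rewrite /delay_itv /= !in_itv /=.
  move=> /andP[u1 u2]; rewrite -mulrN lerD2l ler_pM2l// u1/= gerDl.
  by rewrite pmulr_rle0.
have valc : continuous (val : delay_itv -> R).
  by move=> u; exact: (@initial_continuous _ _ (set_val : delay_itv -> R)).
have hc : (fun u : delay_itv => t + eps * val u) @ s --> t + eps * val s.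
  have ec : (fun u : delay_itv => eps * val u) @ s --> eps * val s.
    by apply: (cvgM (F := nbhs s)); [exact: cvg_cst|exact: valc].
  by apply: (cvgD (F := nbhs s)); [exact: cvg_cst|exact: ec].
have xw : x @ within D (nbhs (t + eps * val s)) --> x (t + eps * val s).
  by rewrite (nbhs_subspace_in (inD s)); exact: xc.
move=> A /xw /= xA; have := hc _ xA.
by apply: (@filterS _ (nbhs s)) => u; apply; exact: inD.
Qed.

End HistorySpace.

Section Hypotheses.
Context {R : realType} (d : nat) (r : {nonneg R}) (N : 'rV[R]_d -> R).

(* f is only meaningful on R_+ x C: its values at negative times are never
   constrained nor used. *)
Variable f : R -> history d r -> 'rV[R]_d.

Definition continuous_on_Rplus : Prop :=
  forall (t : R) (x : history d r) (eta : R), 0 <= t -> 0 < eta ->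
  exists2 kappa : R, 0 < kappa &
    forall (t' : R) (x' : history d r), 0 <= t' ->
      `|t' - t| < kappa -> supnorm N (x' \- x) < kappa ->
      N (f t' x' - f t x) < eta.

Definition continuous_unif_time : Prop :=
  forall (x : history d r) (eta : R), 0 < eta ->
  exists2 kappa : R, 0 < kappa &
    forall (t : R) (x' : history d r), 0 <= t ->
      supnorm N (x' \- x) < kappa -> N (f t x' - f t x) < eta.

Definition bounded_on_bounded : Prop :=
  forall B : set (history d r),
    (exists M : R, forall x, B x -> supnorm N x <= M) ->
    exists K : R, forall (t : R) (x : history d r), 0 <= t -> B x ->
      N (f t x) <= K.

Definition time_mean (x : history d r) (T : R) : 'rV[R]_d :=
  \row_i (T^-1 * \int[lebesgue_measure]_(t in `[0, T]) f t x ord0 i).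

Definition has_time_means : Prop :=
  forall x : history d r, cvg (time_mean x T @[T --> +oo]).

Definition averaged (x : history d r) : 'rV[R]_d :=
  lim (time_mean x T @[T --> +oo]).

Definition averaged_field (x : 'rV[R]_d) : 'rV[R]_d :=
  averaged (const_history r x).

End Hypotheses.

Section Solutions.
Context {R : realType} (d : nat).
Implicit Types (D : set R) (x y : R -> 'rV[R]_d).

(* A curve is a pair (D, x): the total function x is relevant only on its
   domain of definition D.

   x solves x'(t) = E t x for t in D, t >= 0, on an interval D starting at -a
   and reaching beyond 0.  The difference quotient at t is restricted to the
   nonnegative part of D, so that at 0 (and at max D, if it exists) the
   derivative is one-sided. *)
Definition solves (a : R) (init : (R -> 'rV[R]_d) -> Prop)
    (E : R -> (R -> 'rV[R]_d) -> 'rV[R]_d) D x : Prop :=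
  [/\ [/\ is_interval D, D (- a), D `<=` `[- a, +oo[
        & exists2 s, D s & 0 < s],
      {within D, continuous x},
      init x
    & forall t, D t -> 0 <= t ->
      (s - t)^-1 *: (x s - x t) @[s --> within (D `&` `[0, +oo[) t^']
        --> E t x].

Definition ode_solution (G : 'rV[R]_d -> 'rV[R]_d) (y0 : 'rV[R]_d) :=
  solves 0 (fun y => y 0 = y0) (fun t y => G (y t)).

(* The initial condition x(t) = phi(t / eps) on [- eps r, 0] is written with
   t = eps * th, th in [-r, 0]. *)
Definition delay_solution (r : {nonneg R})
    (f : R -> history d r -> 'rV[R]_d) (phi : history d r) (eps : R) :=
  solves (eps * r%:num) (fun x => forall th : delay_itv r, x (eps * val th) = phi th)
    (fun t x => f (t / eps) (segment r x t eps)).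

(* The following refer to an arbitrary set S of solutions. *)
Variable S : set R -> (R -> 'rV[R]_d) -> Prop.

Definition maximal_solution D x : Prop :=
  S D x /\ forall D' x', S D' x' -> D `<=` D' -> {in D, x' =1 x} -> D' = D.

Definition has_unique_solution : Prop :=
  exists D y,
    [/\ maximal_solution D y,
        forall D' y', maximal_solution D' y' -> D' = D /\ {in D, y' =1 y}
      & forall D' y', S D' y' -> D' `<=` D /\ {in D', y' =1 y}].

End Solutions.

(* Main.v *)
(* All limits are taken along a non-principal ultrafilter on the integers, so
   that bounded sequences converge without extracting subsequences.

   If the conclusion fails, there are eps_n -> 0 and solutions x_n that first
   leave the delta-tube around y at a time t_n <= L.  They are equi-Lipschitz on
   [0, t_n], hence x_n -> z on [0, T] with T = lim t_n.  On a short interval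
   [a, c] around t the segments of x_n are uniformly close to the constant z(t),
   so by (H1) and the mean value inequality x_n(c) - x_n(a) differs by at most
   eta (c - a) from the integral of f(s / eps_n, z(t)) over [a, c], which tends
   to (c - a) G(z(t)).  Thus z' = G(z), and z = y on [0, T] by uniqueness,
   contradicting |z(T) - y(T)| >= delta.

   That x_n can only fail to reach L by leaving the tube rests on a Peano theorem:
   a bounded solution on a bounded interval extends, by Euler polygons started
   near the end of the interval and passing to the limit. *)

Require Import Defs.
From HB Require Import structures.
From mathcomp Require Import all_boot all_order all_algebra.
From mathcomp Require Import all_classical all_reals all_analysis.
From mathcomp Require Import ring lra.
Import Order.TTheory GRing.Theory Num.Theory.
Import numFieldNormedType.Exports.
Local Open Scope classical_set_scope.
Local Open Scope ring_scope.

Set Implicit Arguments.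
Unset Strict Implicit.

(** * Convergence along ultrafilters in compact sets *)

Lemma itvcc_sub (R : realType) (a b a' b' : R) : a' <= a -> b <= b' ->
  `[a, b] `<=` `[a', b'].
Proof.
move=> aa bb s /=; rewrite !in_itv /= => /andP[h1 h2].
by rewrite (le_trans aa h1) (le_trans h2 bb).
Qed.

(** For each neighbourhood of a cluster point, an ultrafilter contains either its preimage or the
    complement; the complement would contradict clustering, so a cluster point is a limit. *)
Lemma ultra_cvg_compact (T : topologicalType) (U : set_system nat)
    (UU : UltraFilter U) (A : set T) (u : nat -> T) :
  compact A -> (forall n, A (u n)) -> exists2 l, A l & u n @[n --> U] --> l.
Proof.
move=> cA Au; have uA : U (u @^-1` A) by apply: filterS filterT => n _; exact: Au.
have [l [Al cl]] := cA (u n @[n --> U]) _ uA.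
exists l => // B lB; have [//|UB] := in_ultra_setVsetC (u @^-1` B) UU.
by have [x [nBx /nBx]] := cl (~` B) B UB lB.
Qed.

(** * Equivalence of norms; continuity and derivatives of curves in terms of [N] *)

Section NormedCurves.
Context {R : realType} {d : nat} (N : 'rV[R]_d -> R) (hN : is_norm N).

Lemma is_norm0 : N 0 = 0.
Proof. by rewrite -(scale0r 0) (norm_scale hN) normr0 mul0r. Qed.

Lemma is_normN x : N (- x) = N x.
Proof. by rewrite -scaleN1r (norm_scale hN) normrN1 mul1r. Qed.

Lemma is_normC x y : N (x - y) = N (y - x).
Proof. by rewrite -is_normN opprB. Qed.

Lemma is_norm_ge0 x : 0 <= N x.
Proof.
by have := norm_triangle hN x (- x); rewrite subrr is_norm0 is_normN; lra.
Qed.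

Lemma is_norm_dist z x y : N (x - y) <= N (x - z) + N (z - y).
Proof.
by apply: le_trans (norm_triangle hN _ _); rewrite addrA subrK.
Qed.

Lemma is_norm_sub x y : N x <= N y + N (x - y).
Proof. by apply: le_trans (norm_triangle hN _ _); rewrite addrC subrK. Qed.

Lemma is_norm_sum (I : Type) (s : seq I) (F : I -> 'rV[R]_d) :
  N (\sum_(i <- s) F i) <= \sum_(i <- s) N (F i).
Proof.
elim/big_rec2: _ => [|i y1 y2 _ h]; first by rewrite is_norm0.
by apply: le_trans (norm_triangle hN _ _) _; rewrite lerD2l.
Qed.

Lemma mx_norm_ge_coord (x : 'rV[R]_d) i : `|x ord0 i| <= `|x|.
Proof.
rewrite [leRHS]/Num.norm /= mx_normrE.
by apply: (le_bigmax _ (fun ij : 'I_1 * 'I_d => `|x ij.1 ij.2|) (ord0, i)).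
Qed.

Lemma is_norm_le_mx_norm : exists2 C, 0 < C & forall x, N x <= C * `|x|.
Proof.
(* Expansion in the standard basis; the summand 1 makes the constant positive at once. *)
exists (1 + \sum_(j < d) N (delta_mx 0 j)).
  by apply: ltr_pwDl => //; apply: sumr_ge0 => j _; exact: is_norm_ge0.
move=> x; rewrite {1}(row_sum_delta x); apply: le_trans (is_norm_sum _ _) _.
rewrite mulrDl mul1r mulr_suml; apply: ler_wpDl => //.
apply: ler_sum => j _; rewrite (norm_scale hN) mulrC.
by rewrite ler_wpM2l ?is_norm_ge0// mx_norm_ge_coord.
Qed.

Lemma ultra_cvg_mx_norm (U : set_system nat) (UU : UltraFilter U)
    (u : nat -> 'rV[R]_d) (M : R) :
  (forall n, `|u n| <= M) -> exists l : 'rV[R]_d, u n @[n --> U] --> l.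
Proof.
move=> uM; have cA : compact [set x : 'rV[R]_d | `|x| <= M].
  apply: bounded_closed_compact.
    exists M; split; first exact: num_real.
    by move=> K MK x /= /le_trans; apply; exact: ltW.
  apply: (@preimage_closed _ _ (fun x : 'rV[R]_d => `|x|) [set x | x <= M]).
    by move=> x _; exact: norm_continuous.
  exact: closed_le.
by have [l _ ul] := ultra_cvg_compact UU cA uM; exists l.
Qed.

(** Compactness of the unit sphere: otherwise there are vectors of maximum norm 1 whose [N] tends to
    0. Their limit along an ultrafilter still has maximum norm 1, while [N] vanishes there because
    [N] is dominated by the maximum norm. *)
Lemma mx_norm_le_is_norm : exists2 C, 0 < C & forall x, `|x| <= C * N x.
Proof.
have [C C0 NC] := is_norm_le_mx_norm.
apply: contrapT => H.
have H' n : exists x : 'rV[R]_d, `|x| = 1 /\ N x < n.+1%:R^-1.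
  have : exists x, `|x| > n.+1%:R * N x.
    apply: contrapT => H'; apply: H; exists n.+1%:R => // x.
    by rewrite leNgt; apply/negP => Hx; apply: H'; exists x.
  move=> [x Hx]; have x0 : 0 < `|x|.
    by apply: le_lt_trans Hx; rewrite mulr_ge0 ?is_norm_ge0.
  exists (`|x|^-1 *: x); rewrite normrZ (norm_scale hN) normfV normr_id mulVf ?gt_eqF//.
  split=> //; rewrite -(ltr_pM2l x0) mulrA mulfV ?gt_eqF// mul1r.
  by rewrite ltr_pdivlMr// mulrC.
have [u Hu] := choice H'.
have [U [UU oU]] := @ultraFilterLemma _ (\oo : set_system nat) _.
have [n|l ul] := @ultra_cvg_mx_norm U UU u 1; first by rewrite (Hu n).1.
have l1 : `|l| = 1.
  have : `|u n| @[n --> U] --> `|l| by apply: cvg_norm.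
  have -> : (fun n => `|u n|) = cst 1 by apply/funext => n; rewrite (Hu n).1.
  by move/(cvg_unique _ (cvg_cst _)) => /(_ (@Rhausdorff R)) /esym.
suff l0 : N l = 0.
  by move: l1; rewrite (norm_definite hN l0) normr0 => /eqP; rewrite eq_sym oner_eq0.
apply/eqP; rewrite eq_le is_norm_ge0 andbT; apply/ler_addgt0Pr => e e0.
have e20 : 0 < e / 2 by lra.
have H1 : \forall n \near U, n.+1%:R^-1 < e / 2.
  by apply: oU; exact: near_infty_natSinv_lt (PosNum e20).
have H2 : \forall n \near U, `|l - u n| < e / 2 / C.
  by move/cvgrPdist_lt : ul; apply; rewrite divr_gt0.
have [n [/= n1 n2]] := filter_ex (filterI H1 H2).
have := is_norm_sub l (u n); have := NC (l - u n).
move: n2; rewrite ltr_pdivlMr// [_ * C]mulrC => n2.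
rewrite add0r; have := lt_trans (Hu n).2 n1; lra.
Qed.

Lemma cvg_is_normP (T : Type) (F : set_system T) (FF : Filter F)
    (g : T -> 'rV[R]_d) (l : 'rV[R]_d) :
  g @ F --> l <-> forall e, 0 < e -> \forall s \near F, N (g s - l) < e.
Proof.
have [C C0 NC] := is_norm_le_mx_norm; have [K K0 NK] := mx_norm_le_is_norm.
split=> [/cvgrPdist_lt H e e0|H].
  have : 0 < e / C by rewrite divr_gt0.
  move=> /H; apply: filterS => s; rewrite ltr_pdivlMr// mulrC => Hs.
  by rewrite is_normC; apply: le_lt_trans (NC _) Hs.
apply/cvgrPdist_lt => e e0.
have : 0 < e / K by rewrite divr_gt0.
move=> /H; apply: filterS => s; rewrite ltr_pdivlMr// mulrC => Hs.
by rewrite distrC; apply: le_lt_trans (NK _) Hs.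
Qed.

Definition cont_on (D : set R) (x : R -> 'rV[R]_d) := forall t, D t ->
  forall e, 0 < e -> exists2 rho, 0 < rho &
  forall s, D s -> `|s - t| < rho -> N (x s - x t) < e.

Lemma cont_onP (D : set R) (x : R -> 'rV[R]_d) : {within D, continuous x} <-> cont_on D x.
Proof.
split=> [/subspace_continuousP H t Dt e e0|H].
  have /cvg_is_normP/(_ e e0) := H t Dt.
  rewrite near_withinE => /nbhs_ballP[rho /= rho0 Hr].
  by exists rho => // s Ds st; apply: Hr => //; rewrite /ball /= distrC.
apply/subspace_continuousP => t Dt; apply/cvg_is_normP => e e0.
have [rho rho0 Hr] := H t Dt e e0.
rewrite near_withinE; apply/nbhs_ballP; exists rho => //= s.
by rewrite /ball /= distrC => st Ds; exact: Hr.
Qed.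

(* The derivative condition of [solves], freed of the division by [s - t]. *)
Definition has_rate (D : set R) (x : R -> 'rV[R]_d) t v :=
  forall e, 0 < e -> exists2 rho, 0 < rho &
  forall s, D s -> `|s - t| < rho ->
    N (x s - x t - (s - t) *: v) <= e * `|s - t|.

Lemma has_rateP (D : set R) (x : R -> 'rV[R]_d) t v :
  (s - t)^-1 *: (x s - x t) @[s --> within D t^'] --> v <->
  has_rate D x t v.
Proof.
have E s : s != t -> N ((s - t)^-1 *: (x s - x t) - v) * `|s - t| =
    N (x s - x t - (s - t) *: v).
  move=> st; have st0 : s - t != 0 by rewrite subr_eq0.
  by rewrite mulrC -(norm_scale hN) scalerBr scalerA mulfV// scale1r.
have np s : s != t -> 0 < `|s - t| by move=> st; rewrite normr_gt0 subr_eq0.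
split=> [/cvg_is_normP H e e0|H].
  have := H e e0; rewrite near_withinE near_withinE => /nbhs_ballP[rho /= rho0 Hr].
  exists rho => // s Ds str; have [->|st] := eqVneq s t.
    by rewrite !subrr scale0r subrr is_norm0 normr0 mulr0.
  rewrite -E// ler_wpM2r//; apply/ltW/Hr => //.
  by rewrite /ball /= distrC.
apply/cvg_is_normP => e e0; have e20 : 0 < e / 2 by lra.
have [rho rho0 Hr] := H _ e20.
rewrite near_withinE near_withinE; apply/nbhs_ballP; exists rho => //= s.
rewrite /ball /= distrC => str st Ds; have := Hr _ Ds str.
by rewrite -E// ler_pM2r ?np// => h; apply: le_lt_trans h _; lra.
Qed.

Lemma cont_on_sub (A D : set R) (x : R -> 'rV[R]_d) : A `<=` D -> cont_on D x -> cont_on A x.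
Proof.
move=> AD H t /AD Dt e e0; have [rho r0 Hr] := H t Dt e e0.
by exists rho => // s /AD Ds; exact: Hr.
Qed.

Lemma has_rate_sub (A D : set R) (x : R -> 'rV[R]_d) t v :
  A `<=` D -> has_rate D x t v -> has_rate A x t v.
Proof.
move=> AD H e e0; have [rho r0 Hr] := H e e0.
by exists rho => // s /AD Ds; exact: Hr.
Qed.

Lemma has_rate_cont (D : set R) (x : R -> 'rV[R]_d) :
  (forall t, D t -> exists v, has_rate D x t v) -> cont_on D x.
Proof.
move=> H t Dt e e0; have [v Hv] := H t Dt.
have [rho r0 Hr] := Hv 1 ltr01.
have c0 : 0 < 1 + N v by have := is_norm_ge0 v; lra.
exists (Num.min rho (e / (1 + N v))); first by rewrite lt_min r0 divr_gt0.
move=> s Ds; rewrite lt_min => /andP[sr]; rewrite ltr_pdivlMr// => se.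
apply: le_lt_trans se; have := Hr s Ds sr.
have := norm_triangle hN (x s - x t - (s - t) *: v) ((s - t) *: v).
rewrite subrK (norm_scale hN); lra.
Qed.

End NormedCurves.

(** * Mean value inequality and derivatives recovered from secants *)

Section MeanValue.
Context {R : realType} {d : nat} (N : 'rV[R]_d -> R) (hN : is_norm N).

(** Euler polygons have corners, so only right derivatives are assumed and the bound is propagated
    by a supremum argument: the last time at which it holds, with a slightly larger slope, is
    attained by continuity, and before [c] the right derivative would carry the bound further. *)
Lemma mean_value (u : R -> 'rV[R]_d) (a c : R) g eta : a <= c ->
  cont_on N `[a, c] u ->
  (forall s, a <= s -> s < c ->
    exists2 v, N (v - g) <= eta & has_rate N `[s, c] u s v) ->
  N (u c - u a - (c - a) *: g) <= eta * (c - a).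
Proof.
move=> ac cu H; have [<-|nac] := eqVneq a c.
  by rewrite !subrr scale0r subrr is_norm0// mulr0.
have {nac}ltac : a < c by rewrite lt_neqAle nac.
have eta0 : 0 <= eta.
  by have [v vg _] := H a (lexx _) ltac; apply: le_trans vg; exact: is_norm_ge0.
apply/ler_addgt0Pr => e e0.
(* The extra slope absorbs the error of the right derivative and costs only [e] over the whole
   interval. *)
pose k := eta + e / (c - a).
have ca0 : 0 < c - a by lra.
have k0 : 0 < k by rewrite ltr_wpDl// divr_gt0.
have -> : eta * (c - a) + e = k * (c - a) by rewrite mulrDl divfK// gt_eqF.
pose w t := N (u t - u a - (t - a) *: g).
have wD s t : w t <= w s + N (u t - u s - (t - s) *: g).
  apply: le_trans (norm_triangle hN _ _); rewrite le_eqVlt; apply/orP; left.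
  apply/eqP; congr N; apply/rowP => i; rewrite !mxE; ring.
pose S := [set t | [/\ a <= t, t <= c & w t <= k * (t - a)]].
have Sa : S a by split=> //; rewrite /w !subrr scale0r subrr is_norm0// mulr0.
have Sc : ubound S c by move=> t [].
have hS : has_sup S by split; [exists a|exists c].
have aS : a <= sup S by apply: ub_le_sup Sa; exists c.
have Sle : sup S <= c by apply: ge_sup => //; exists a.
(* The bound passes from nearby points of [S] to [sup S]: one half of [e1] pays for the change of
   [u], the other for that of the linear term. *)
have SS : S (sup S).
  split=> //; apply/ler_addgt0Pr => e1 e10.
  have e20 : 0 < e1 / 2 by lra.
  have g1 : 0 < 1 + N g by have := is_norm_ge0 hN g; lra.
  have [|rho rho0 Hr] := cu (sup S) _ (e1 / 2) e20; first by rewrite /= in_itv /= aS.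
  have m0 : 0 < Num.min rho (e1 / 2 / (1 + N g)) by rewrite lt_min rho0 divr_gt0.
  have [s Ss sS] := sup_adherent m0 hS.
  have sS' : s <= sup S by apply: ub_le_sup Ss; exists c.
  have [as_ sc ws] := Ss.
  have : sup S - s < Num.min rho (e1 / 2 / (1 + N g)) by lra.
  rewrite lt_min => /andP[s1]; rewrite ltr_pdivlMr// => s2.
  have := Hr s; rewrite /= in_itv /= as_ sc distrC ger0_norm ?subr_ge0// => /(_ isT s1).
  rewrite (is_normC hN) => h1; have h2 := wD s (sup S).
  have := norm_triangle hN (u (sup S) - u s) (- ((sup S - s) *: g)).
  rewrite (is_normN hN) (norm_scale hN).
  rewrite ger0_norm ?subr_ge0// => h3.
  have h4 : k * (s - a) <= k * (sup S - a) by rewrite ler_pM2l//; lra.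
  lra.
have [Slt|] := ltP (sup S) c; last first.
  move=> cS; have E : sup S = c by apply/eqP; rewrite eq_le Sle.
  by have [_ _] := SS; rewrite E.
have [v vg rv] := H _ aS Slt.
have e20 : 0 < e / (c - a) by rewrite divr_gt0.
have [rho rho0 Hr] := rv _ e20.
(* A point beyond [sup S] within reach of the derivative estimate; it turns out to lie in [S], a
   contradiction. *)
pose s := Num.min c (sup S + rho / 2).
have sc : s <= c by rewrite ge_min lexx.
have Ss : sup S < s by rewrite lt_min Slt; lra.
have srho : s - sup S < rho.
  have : s <= sup S + rho / 2 by rewrite ge_min lexx orbT.
  lra.
have := Hr s; rewrite /= in_itv /= sc (ltW Ss) ger0_norm ?subr_ge0 ?(ltW Ss)//.
move=> /(_ isT srho) h1.
suff Ss' : S s by have := ub_le_sup (ex_intro _ c Sc) Ss'; rewrite leNgt Ss.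
split=> //; first by lra.
have [_ _ h2] := SS; have h3 := wD (sup S) s.
have h4 : N (u s - u (sup S) - (s - sup S) *: g) <=
    N (u s - u (sup S) - (s - sup S) *: v) + N ((s - sup S) *: (v - g)).
  apply: le_trans (norm_triangle hN _ _); rewrite le_eqVlt; apply/orP; left.
  by apply/eqP; congr N; apply/rowP => i; rewrite !mxE; ring.
have h5 : (s - sup S) * N (v - g) <= (s - sup S) * eta by rewrite ler_wpM2l//; lra.
move: h4; rewrite (norm_scale hN) ger0_norm; last by lra.
have -> : k * (s - a) = k * (sup S - a) + (eta * (s - sup S) + e / (c - a) * (s - sup S)).
  by rewrite /k; ring.
lra.
Qed.

Lemma mean_value_lip (u : R -> 'rV[R]_d) (a c K : R) :
  cont_on N `[a, c] u ->
  (forall s, a <= s -> s < c ->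
    exists2 v, N v <= K & has_rate N `[s, c] u s v) ->
  forall s t, a <= s -> s <= c -> a <= t -> t <= c ->
    N (u t - u s) <= K * `|t - s|.
Proof.
move=> cu H; have main s t : a <= s -> s <= t -> t <= c ->
    N (u t - u s) <= K * `|t - s|.
  move=> as_ st tc; have := @mean_value u s t 0 K st.
  rewrite scaler0 subr0 ger0_norm ?subr_ge0//; apply.
    apply: cont_on_sub cu => z /=; rewrite !in_itv /= => /andP[h1 h2].
    by apply/andP; split; lra.
  move=> z sz zt; have [||v vK rv] := H z; [lra|lra|].
  exists v; first by rewrite subr0.
  by apply: has_rate_sub rv => w /=; rewrite !in_itv /= => /andP[h1 h2]; apply/andP; split; lra.
move=> s t as_ sc at_ tc; have [st|ts] := leP s t; first exact: main.
by rewrite (is_normC hN) distrC main// ltW.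
Qed.

(* At [t = 0] the segments of the approximations still see the history, hence the
   restriction to secants with end points in the open interval. *)
Lemma secants_has_rate (z : R -> 'rV[R]_d) (T K t : R) g :
  (forall s s', 0 <= s -> s <= T -> 0 <= s' -> s' <= T -> N (z s' - z s) <= K * `|s' - s|) ->
  0 <= t -> t <= T ->
  (forall eta, 0 < eta -> exists2 rho, 0 < rho & forall a c, 0 < a -> a < c -> c < T ->
    `|a - t| < rho -> `|c - t| < rho -> N (z c - z a - (c - a) *: g) <= eta * (c - a)) ->
  has_rate N `[0, T] z t g.
Proof.
move=> zK t0 tT H e e0; have [rho rho0 Hr] := H e e0.
(* The secant bound extends to the end points 0 and [T] by the Lipschitz continuity of [z]. *)
have cl a c : 0 <= a -> a < c -> c <= T -> `|a - t| < rho -> `|c - t| < rho ->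
    N (z c - z a - (c - a) *: g) <= e * (c - a).
  move=> a0 ac cT ar cr; apply/ler_addgt0Pr => e1 e10.
  have K0 : 0 <= K.
    have := zK a c a0 _ _ cT; have := is_norm_ge0 hN (z c - z a) => h.
    move=> /(_ _ _)/(le_trans h) h1; have {}h1 := h1 ltac:(lra) ltac:(lra).
    by move: h1; rewrite pmulr_lge0// normr_gt0 subr_eq0 gt_eqF.
  pose B := 1 + K + N g; have g0 := is_norm_ge0 hN g.
  have B0 : 0 < B by rewrite /B; lra.
  (* Moving both end points inwards by [q] costs at most [2 * q * (K + N g)], which is at most [e1];
     the bound by [(c - a) / 4] keeps [a + q < c - q]. *)
  pose q := Num.min ((c - a) / 4) (e1 / (2 * B)).
  have q0 : 0 < q by rewrite lt_min !divr_gt0 ?mulr_gt0//; lra.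
  have q1 : q <= (c - a) / 4 by rewrite ge_min lexx.
  have q2 : q <= e1 / (2 * B) by rewrite ge_min lexx orbT.
  have qe : 2 * q * B <= e1.
    by move: q2; rewrite ler_pdivlMr ?mulr_gt0// => h; lra.
  move: ar cr; rewrite !ltr_norml => /andP[ar1 ar2] /andP[cr1 cr2].
  have := Hr (a + q) (c - q).
  rewrite !ltr_norml => /(_ ltac:(lra) ltac:(lra) ltac:(lra)).
  move=> /(_ ltac:(by apply/andP; split; lra) ltac:(by apply/andP; split; lra)) h1.
  have z1 : N (z (a + q) - z a) <= K * q.
    have := zK a (a + q); rewrite (_ : a + q - a = q); last by ring.
    by rewrite (gtr0_norm q0); apply; lra.
  have z2 : N (z c - z (c - q)) <= K * q.
    have := zK (c - q) c; rewrite (_ : c - (c - q) = q); last by ring.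
    by rewrite (gtr0_norm q0); apply; lra.
  have -> : z c - z a - (c - a) *: g = (z (c - q) - z (a + q) - (c - q - (a + q)) *: g) +
      ((z c - z (c - q)) + ((z (a + q) - z a) + (- (2 * q)) *: g)).
    by apply/rowP => i; rewrite !mxE; ring.
  apply: le_trans (norm_triangle hN _ _) _.
  have h2 := norm_triangle hN (z c - z (c - q)) ((z (a + q) - z a) + (- (2 * q)) *: g).
  have := norm_triangle hN (z (a + q) - z a) ((- (2 * q)) *: g).
  rewrite (norm_scale hN) normrN gtr0_norm; last by lra.
  have h5 : e * (c - q - (a + q)) <= e * (c - a) by rewrite ler_pM2l//; lra.
  move: qe; rewrite /B; have := mulr_ge0 (ltW q0) g0; have := mulr_ge0 (ltW q0) K0.
  lra.
exists rho => // s; rewrite /= in_itv /= => /andP[s0 sT] sr.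
have t00 : `|t - t| < rho by rewrite subrr normr0.
have [ts|st|->] := ltgtP t s.
- by rewrite (gtr0_norm (_ : 0 < s - t)) ?subr_gt0//; exact: cl.
- rewrite (ltr0_norm (_ : s - t < 0)) ?subr_lt0// opprB.
  have -> : z s - z t - (s - t) *: g = - (z t - z s - (t - s) *: g).
    by apply/rowP => i; rewrite !mxE; ring.
  by rewrite (is_normN hN); exact: cl.
- by rewrite !subrr scale0r subrr is_norm0// normr0 mulr0.
Qed.

End MeanValue.

(** * Pointwise and uniform ultrafilter limits of curves *)

Section UltraLimits.
Context {R : realType} {d : nat} (N : 'rV[R]_d -> R) (hN : is_norm N).
Context (U : set_system nat) {UU : UltraFilter U}.

Lemma ultra_lim (u : nat -> 'rV[R]_d) (M : R) : (forall n, N (u n) <= M) ->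
  exists l, forall e, 0 < e -> \forall n \near U, N (u n - l) < e.
Proof.
move=> uM; have [C C0 NC] := mx_norm_le_is_norm hN.
have [n|l ul] := @ultra_cvg_mx_norm _ _ U UU u (C * M).
  by apply: le_trans (NC _) _; rewrite ler_pM2l.
by exists l; apply/(cvg_is_normP hN).
Qed.

Lemma ultra_lim_real (u : nat -> R) (a b : R) : (forall n, a <= u n <= b) ->
  exists2 l, a <= l <= b & forall e, 0 < e -> \forall n \near U, `|u n - l| < e.
Proof.
move=> uab; have [n|l /= abl ul] := ultra_cvg_compact UU (@segment_compact R a b) (u := u).
  by rewrite /= in_itv /=.
exists l; first by move: abl; rewrite in_itv.
by move=> e e0; move/cvgrPdist_lt : ul => /(_ e e0); apply: filterS => n; rewrite distrC.
Qed.

Lemma ultra_lim_le (u v : nat -> 'rV[R]_d) l m M :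
  (forall e, 0 < e -> \forall n \near U, N (u n - l) < e) ->
  (forall e, 0 < e -> \forall n \near U, N (v n - m) < e) ->
  (\forall n \near U, N (u n - v n) <= M) -> N (l - m) <= M.
Proof.
move=> ul vm uv; apply/ler_addgt0Pr => e e0; have e20 : 0 < e / 2 by lra.
have [n [[/= h1 h2] /= h3]] := filter_ex (filterI (filterI (ul _ e20) (vm _ e20)) uv).
have := is_norm_dist hN (u n) l m; have := is_norm_dist hN (v n) (u n) m.
rewrite (is_normC hN l (u n)); lra.
Qed.

(** Equicontinuity spreads each pointwise limit over a ball, and compactness in its near-covering
    form joins the balls. The displaced argument [s'] serves to compare segments taken at different
    times. *)
Lemma ultra_unif_lim (A : set R) (u : nat -> R -> 'rV[R]_d) z : compact A ->
  (forall s, A s -> forall e, 0 < e -> exists2 rho, 0 < rho &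
    forall n s', A s' -> `|s' - s| < rho -> N (u n s' - u n s) < e) ->
  (forall s, A s -> forall e, 0 < e -> \forall n \near U, N (u n s - z s) < e) ->
  forall e, 0 < e -> exists2 rho, 0 < rho & \forall n \near U,
    forall s s', A s -> A s' -> `|s' - s| < rho -> N (u n s - z s') < e.
Proof.
move=> /compact_near_coveringP cA ue uz e e0; have e40 : 0 < e / 4 by lra.
(* The index pairs [n] with the admissible displacement, so that a single covering argument selects
   both. *)
pose P (i : nat * R) s := A s -> forall s', A s' -> `|s' - s| < i.2 -> N (u i.1 s - z s') < e.
have [|[B Q] /= [UB Q0] BQ] := cA _ (filter_prod U (0 : R)^'+) P _.
  move=> s As; have [rho rho0 Hr] := ue s As _ e40.
  exists (ball s (rho / 2),
    [set i : nat * R | N (u i.1 s - z s) < e / 4 /\ i.2 < rho / 2]).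
    split => /=; first by apply: nbhsx_ballx; lra.
    exists ([set n | N (u n s - z s) < e / 4], [set r | r < rho / 2]).
      split => /=; first exact: uz.
      by apply: nbhs_right_lt; lra.
    by move=> [n r] /= [].
  move=> [s1 [n r]] /= [ss1 [h1 h2]] As1 s2 As2 /= s12.
  have r1 : `|s1 - s| < rho / 2 by move: ss1; rewrite /ball /= distrC.
  have r2 : `|s2 - s| < rho.
    have -> : s2 - s = (s2 - s1) + (s1 - s) by ring.
    by apply: le_lt_trans (ler_normD _ _) _; move: s12 r1; rewrite /=; lra.
  (* The limit inherits the modulus of continuity of the family. *)
  have h3 : N (z s2 - z s) <= e / 4.
    apply: ultra_lim_le (uz s2 As2) (uz s As) _.
    by apply: nearW => k; apply/ltW/Hr.
  have r3 : `|s1 - s| < rho by lra.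
  have h4 := Hr n s1 As1 r3.
  have := is_norm_dist hN (u n s) (u n s1) (z s2).
  have := is_norm_dist hN (z s) (u n s) (z s2).
  by rewrite (is_normC hN (z s) (z s2)); lra.
have [r [Qr r0]] := filter_ex (filterI Q0 (nbhs_right_gt (0:R))).
exists r => //; apply: filterS UB => n Bn s s' As As' ss'.
by have /= := BQ (n, r) (conj Bn Qr) s As As s' As' ss'.
Qed.

End UltraLimits.

Lemma exists_ultra : exists U : set_system nat, UltraFilter U /\ \oo `<=` U.
Proof. exact: ultraFilterLemma. Qed.

(** * Segments of curves and their sup norm *)

Section Segments.
Context {R : realType} {d : nat} (N : 'rV[R]_d -> R) (hN : is_norm N).
Context {r : {nonneg R}}.

Lemma supnorm_le (g : delay_itv r -> 'rV[R]_d) M :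
  (forall th, N (g th) <= M) -> supnorm N g <= M.
Proof.
move=> gM; apply: ge_sup; first by exists (N (g (now r))); exists (now r).
by move=> _ [th _ <-].
Qed.

Lemma delay_itvE (th : delay_itv r) : - r%:num <= val th <= 0.
Proof. by have := set_valP th; rewrite /delay_itv /= in_itv. Qed.

(** Causality: an Euler polygon can be prolonged without altering the field along its earlier
    part. *)
Lemma eq_segment (x x' : R -> 'rV[R]_d) t eps : 0 < eps ->
  (forall s, s <= t -> x s = x' s) -> segment r x t eps = segment r x' t eps.
Proof.
move=> e0 xx'; rewrite /segment.
have -> // : (fun th : delay_itv r => x (t + eps * val th)) = fun th => x' (t + eps * val th).
apply/funext => th; apply: xx'; have /andP[_ th0] := delay_itvE th.
by rewrite gerDl pmulr_rle0.
Qed.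

Lemma delay_itv_scale t eps (th : delay_itv r) : 0 < eps ->
  t - eps * r%:num <= t + eps * val th <= t.
Proof.
move=> e0; have /andP[h1 h2] := delay_itvE th.
by rewrite gerDl pmulr_rle0// h2 andbT lerD2l -mulrN ler_pM2l.
Qed.

Lemma cont_segmentE (x : R -> 'rV[R]_d) t eps c : 0 < eps -> 0 <= t -> t <= c ->
  cont_on N `[- (eps * r%:num), c] x ->
  forall th : delay_itv r, segment r x t eps th = x (t + eps * val th).
Proof.
move=> e0 t0 tc /(cont_onP hN) cx; apply: segmentE e0 cx _ => s /=.
by rewrite !in_itv /= => /andP[h1 h2]; apply/andP; split; lra.
Qed.

End Segments.

Lemma ler_dist_min (R : realDomainType) (s t e : R) :
  `|Num.min s e - Num.min t e| <= `|s - t|.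
Proof.
by case: (leP s e); case: (leP t e) => *; rewrite ler_norml; case: (ger0P (s - t)); lra.
Qed.

Lemma ler_dist_max (R : realDomainType) (s t e : R) :
  `|Num.max e s - Num.max e t| <= `|s - t|.
Proof.
by case: (leP e s); case: (leP e t) => *; rewrite ler_norml; case: (ger0P (s - t)); lra.
Qed.

(** * Euler polygons for the delay equation *)

Section EulerPaths.
Context {R : realType} {d : nat} (N : 'rV[R]_d -> R) (hN : is_norm N).
Context {r : {nonneg R}} (f : R -> history d r -> 'rV[R]_d).
Context (eps : R) (eps0 : 0 < eps) (M K : R) (K0 : 0 <= K).
Hypothesis fK : forall (t : R) (xi : history d r),
  0 <= t -> supnorm N xi <= M + 1 -> N (f t xi) <= K.

Local Notation lag := (eps * r%:num).

Let lag0 : 0 <= lag. Proof. by rewrite mulr_ge0// ltW. Qed.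

Definition delay_field (t : R) (x : R -> 'rV[R]_d) := f (t / eps) (segment r x t eps).

Lemma delay_field_le (u : R -> 'rV[R]_d) t c : 0 <= t -> t <= c ->
  cont_on N `[- lag, c] u -> (forall s, - lag <= s -> s <= c -> N (u s) <= M + 1) ->
  N (delay_field t u) <= K.
Proof.
move=> t0 tc cu uM; apply: fK; first by rewrite divr_ge0// ltW.
apply: supnorm_le => th; rewrite (cont_segmentE hN eps0 t0 tc cu).
have /andP[h1 h2] := delay_itv_scale t th eps0.
by apply: uM; [apply: le_trans h1; rewrite lerBrDr addrC subrr|exact: le_trans h2 tc].
Qed.

Lemma eq_delay_field (u v : R -> 'rV[R]_d) t : (forall s, s <= t -> u s = v s) ->
  delay_field t u = delay_field t v.
Proof. by move=> uv; rewrite /delay_field (eq_segment eps0 uv). Qed.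

Context (D : set R) (x : R -> 'rV[R]_d) (iD : is_interval D) (Da : D (- lag)).
Hypothesis cx : cont_on N D x.
Hypothesis rx : forall t, D t -> 0 <= t ->
  has_rate N (D `&` `[0, +oo[) x t (delay_field t x).
Hypothesis xM : forall t, D t -> N (x t) <= M.

(** Each step continues the curve linearly with the field at its current end, so the slope at [s] is
    the field at a time at most [h] earlier; before [tau] the curve is [x] itself and [s' = s]. The
    budget [h * m%:R * K <= 1] keeps the polygon below [M + 1], where [fK] bounds the next slope by
    [K]. *)
Lemma euler_path (tau h : R) (m : nat) : D tau -> 0 <= tau -> 0 < h ->
  h * m%:R * K <= 1 -> exists u : R -> 'rV[R]_d,
  [/\ forall s : R, s <= tau -> u s = x s,
      cont_on N `[- lag, tau + h * m%:R] u,
      forall s : R, 0 <= s -> s < tau + h * m%:R ->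
        exists s' : R, [/\ 0 <= s', s - h <= s', s' <= s &
        has_rate N `[s, tau + h * m%:R] u s (delay_field s' u)] &
      forall s : R, - lag <= s -> s <= tau + h * m%:R ->
        N (u s) <= M + K * Num.max 0 (s - tau)].
Proof.
have a0 := lag0; have k0 := K0.
move=> Dtau tau0 h0; elim: m => [_|m IH hm].
  have subD (s : R) : - lag <= s -> s <= tau -> D s.
    by move=> s1 s2; apply: (iD Da Dtau); rewrite s1.
  exists x; rewrite mulr0 addr0; split=> //.
  - by apply: cont_on_sub cx => s /=; rewrite in_itv /= => /andP[]; exact: subD.
  - move=> s s0 st; exists s; split=> //; first by lra.
    have Ds : D s by apply: subD; lra.
    apply: has_rate_sub (rx Ds s0).
    move=> w /=; rewrite !in_itv /= andbT => /andP[sw wt].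
    by split; [apply: subD; lra|lra].
  - move=> s s1 s2; rewrite max_l; last by lra.
    by rewrite mulr0 addr0; apply/xM/subD.
have hK0 : 0 <= h * K by rewrite mulr_ge0// ltW.
have mE : h * m.+1%:R = h * m%:R + h by rewrite -natr1; ring.
have {}hm : h * m%:R * K + h * K <= 1 by rewrite -mulrDl -mE.
have [|u [ux cu ru uM]] := IH; first by lra.
set e := tau + h * m%:R in cu ru uM.
have -> : tau + h * m.+1%:R = e + h by rewrite mE /e; ring.
have te : tau <= e by rewrite /e lerDl mulr_ge0// ltW.
have e0 : 0 <= e by lra.
have eK : K * (e - tau) + h * K <= 1.
  have -> : e - tau = h * m%:R by rewrite /e; ring.
  by rewrite mulrC.
pose v := delay_field e u.
have vK : N v <= K.
  apply: delay_field_le e0 (lexx _) cu _ => s s1 s2.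
  apply: le_trans (uM _ s1 s2) _; rewrite lerD2l.
  apply: (@le_trans _ _ (K * (e - tau))); last by lra.
  by rewrite ler_wpM2l// ge_max; apply/andP; split; lra.
(* The old curve is frozen after [e] and a linear piece is added; in this form continuity across [e]
   follows from [min] and [max] being 1-Lipschitz. *)
pose u' s := u (Num.min s e) + Num.max 0 (s - e) *: v.
have u'E s : s <= e -> u' s = u s.
  by move=> se; rewrite /u' min_l// max_l ?scale0r ?addr0//; lra.
have u'D s : e <= s -> u' s = u e + (s - e) *: v.
  by move=> se; rewrite /u' min_r// max_r// subr_ge0.
exists u'; split.
- by move=> s st; rewrite u'E ?ux//; lra.
- move=> t; rewrite /= in_itv /= => /andP[t1 t2] e1 e10.
  have e120 : 0 < e1 / 2 by lra.
  have mt : Num.min t e \in `[- lag, e].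
    by rewrite in_itv /= le_min t1 ge_min lexx orbT andbT /=; lra.
  have [rho rho0 Hr] := cu _ mt _ e120.
  have Nv : 0 < 1 + N v by have := is_norm_ge0 hN v; lra.
  exists (Num.min rho (e1 / 2 / (1 + N v))); first by rewrite lt_min rho0 divr_gt0.
  move=> s; rewrite /= in_itv /= lt_min => /andP[s1 s2] /andP[st1].
  rewrite ltr_pdivlMr// => st2.
  have min1 : `|Num.min s e - Num.min t e| <= `|s - t|.
    exact: ler_dist_min.
  have max1 : `|Num.max 0 (s - e) - Num.max 0 (t - e)| <= `|s - t|.
    by apply: le_trans (ler_dist_max _ _ _) _; rewrite opprB addrA subrK.
  have ms : Num.min s e \in `[- lag, e].
    by rewrite in_itv /= le_min s1 ge_min lexx orbT andbT /=; lra.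
  have h1 := Hr _ ms (le_lt_trans min1 st1).
  have h2 : N ((Num.max 0 (s - e) - Num.max 0 (t - e)) *: v) <= `|s - t| * N v.
    by rewrite (norm_scale hN) ler_wpM2r// is_norm_ge0.
  have -> : u' s - u' t = (u (Num.min s e) - u (Num.min t e)) +
      (Num.max 0 (s - e) - Num.max 0 (t - e)) *: v.
    by rewrite /u'; apply/rowP => i; rewrite !mxE; ring.
  apply: le_lt_trans (norm_triangle hN _ _) _.
  have := normr_ge0 (s - t); lra.
- move=> s s0 se; have [les|lse] := leP e s.
    exists e; split=> //; first by lra.
    (* By causality the field at [e] does not see the new piece. *)
    have -> : delay_field e u' = v by apply: eq_delay_field => w; exact: u'E.
    move=> e1 e10; exists 1 => // w; rewrite /= in_itv /= => /andP[w1 w2] _.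
    rewrite !u'D//; last by lra.
    have -> : u e + (w - e) *: v - (u e + (s - e) *: v) - (w - s) *: v = 0.
      by apply/rowP => i; rewrite !mxE; ring.
    by rewrite is_norm0// mulr_ge0// ltW.
  have [s' [s'0 hs' s's rs]] := ru s s0 lse.
  exists s'; split=> //.
  have -> : delay_field s' u' = delay_field s' u.
    by apply: eq_delay_field => w ws; apply: u'E; lra.
  move=> e1 e10; have [rho rho0 Hr] := rs e1 e10.
  (* Within distance [e - s] only the old piece is visible. *)
  exists (Num.min rho (e - s)); first by rewrite lt_min rho0 subr_gt0.
  move=> w; rewrite /= in_itv /= lt_min => /andP[sw wh] /andP[w1 w2].
  have we : w <= e by move: w2; rewrite ltr_norml; lra.
  by rewrite !u'E//; [apply: Hr => //; rewrite /= in_itv /= sw|lra].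
- move=> s s1 s2; have [les|/ltW lse] := leP e s; last by rewrite u'E//; exact: uM.
  rewrite u'D//; apply: le_trans (norm_triangle hN _ _) _.
  have ae : - lag <= e by lra.
  have := uM e ae (lexx _); rewrite (norm_scale hN) !max_r; try lra.
  rewrite ger0_norm ?subr_ge0// => h1.
  have h2 : (s - e) * N v <= (s - e) * K by rewrite ler_wpM2l// subr_ge0.
  have -> : K * (s - tau) = K * (e - tau) + (s - e) * K by ring.
  lra.
Qed.

End EulerPaths.

(** * Peano continuation of bounded solutions *)

Lemma ultra_lim_secant (R : realType) d (N : 'rV[R]_d -> R) (hN : is_norm N)
    (U : set_system nat) {UU : UltraFilter U} (u v : nat -> 'rV[R]_d) l m w M :
  (forall e, 0 < e -> \forall n \near U, N (u n - l) < e) ->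
  (forall e, 0 < e -> \forall n \near U, N (v n - m) < e) ->
  (\forall n \near U, N (u n - v n - w) <= M) -> N (l - m - w) <= M.
Proof.
move=> ul vm uvw; rewrite -addrA -opprD.
apply: (@ultra_lim_le _ _ _ hN U _ u (fun n => v n + w)) => //.
  by move=> e e0; apply: filterS (vm e e0) => n; rewrite opprD addrACA subrr addr0.
by apply: filterS uvw => n; rewrite opprD addrA.
Qed.

(** Since [x] may have no value at [b = sup D], polygons start from [x] at times tending to [b] and
    run to a common time [c > b], with steps of order [n.+1%:R^-1]. They are equicontinuous, and
    their limit agrees with [x] on [D] and solves the equation up to [c]. *)
Lemma delay_solution_extends (R : realType) d (N : 'rV[R]_d -> R) (hN : is_norm N)
    (r : {nonneg R}) (f : R -> history d r -> 'rV[R]_d) (hf : continuous_on_Rplus N f)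
    (phi : history d r) (eps : R) D x (M K : R) :
  0 < eps -> 0 < K ->
  (forall (t : R) (xi : history d r), 0 <= t -> supnorm N xi <= M + 1 -> N (f t xi) <= K) ->
  delay_solution f phi eps D x -> (forall t, D t -> N (x t) <= M) -> has_ubound D ->
  exists D' x', [/\ delay_solution f phi eps D' x', D `<=` D', {in D, x' =1 x} & D' <> D].
Proof.
move=> eps0 K0 fK [[iD Da Dlag [s1 Ds1 s10]] /(cont_onP hN) cx ix rx] xM ubD.
have lag0 : 0 <= eps * r%:num by rewrite mulr_ge0// ltW.
have {}rx t : D t -> 0 <= t ->
    has_rate N (D `&` `[0, +oo[) x t (delay_field f eps t x).
  by move=> Dt t0; apply/(has_rateP hN)/rx.
pose b := sup D.
have Db t : D t -> t <= b by move=> Dt; apply: ub_le_sup Dt.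
have b0 : 0 < b by apply: lt_le_trans s10 (Db _ Ds1).
have D0 (t : R) : - (eps * r%:num) <= t -> t <= 0 -> D t.
  by move=> t1 t2; apply: (iD _ _ Da Ds1); rewrite t1 (le_trans t2)// ltW.
(* A polygon starts after [b - sg] and stops at [b + sg], so it runs for at most [2 * sg], which
   exactly meets the budget of [euler_path]. *)
pose sg := (2 * K)^-1; have sg0 : 0 < sg by rewrite invr_gt0 mulr_gt0.
have sgK : 2 * sg * K = 1 by rewrite /sg; field; rewrite gt_eqF.
pose c := b + sg.
have : forall n : nat, exists u : R -> 'rV[R]_d,
  [/\ exists tau : R, [/\ 0 <= tau, b - n.+1%:R^-1 < tau, (D b -> tau = b) &
        forall s : R, s <= tau -> u s = x s],
      cont_on N `[- (eps * r%:num), c] u,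
      forall s : R, 0 <= s -> s < c -> exists s' : R, [/\ 0 <= s',
        s - (2 * sg) * n.+1%:R^-1 <= s', s' <= s &
        has_rate N `[s, c] u s (delay_field f eps s' u)] &
      forall s : R, - (eps * r%:num) <= s -> s <= c -> N (u s) <= M + 1].
  move=> n; have : exists tau : R, [/\ D tau, 0 <= tau, b - n.+1%:R^-1 < tau,
      b - sg < tau & D b -> tau = b].
    have n0 : (0 : R) < n.+1%:R^-1 by [].
    have [Dbb|nDb] := pselect (D b).
      by exists b; split=> //; rewrite ?ltrBlDr ?ltrDl// ltW.
    (* The three bounds make [tau] positive, close enough to [b] for the budget, and convergent to
       [b]. *)
    have m0 : 0 < Num.min b (Num.min sg n.+1%:R^-1) by rewrite !lt_min b0 sg0.
    have [tau Dtau] := sup_adherent m0 (conj (ex_intro _ s1 Ds1) ubD).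
    rewrite -/b ltrBlDr -ltrBlDl !lt_min => /and3P[h1 h2 h3].
    by exists tau; split; rewrite // ?ltrBlDr -?ltrBlDl//; lra.
  move=> [tau [Dtau tau0 tn tsg tb]].
  have taub := Db _ Dtau.
  have tc : 0 < c - tau by rewrite /c; lra.
  have tc2 : c - tau <= 2 * sg by rewrite /c; lra.
  have hm : (c - tau) / n.+1%:R * n.+1%:R = c - tau by rewrite divfK// pnatr_eq0.
  have cE : tau + (c - tau) = c by ring.
  have tcK : (c - tau) * K <= 1 by rewrite -sgK ler_wpM2r// ltW.
  have := @euler_path _ _ N hN r f eps eps0 M K (ltW K0) fK D x iD Da cx rx xM
    tau ((c - tau) / n.+1%:R) n.+1 Dtau tau0.
  rewrite hm cE divr_gt0// => /(_ isT tcK)[u [ux cu ru uM]].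
  exists u; split=> //.
  - by exists tau.
  - move=> s s0 sc; have [s' [h1 h2 h3 h4]] := ru s s0 sc; exists s'; split=> //.
    apply: le_trans h2; rewrite lerD2l lerN2 ler_pM2r//.
  - move=> s h1 h2; apply: le_trans (uM s h1 h2) _; rewrite lerD2l.
    apply: (@le_trans _ _ (K * (c - tau))); last by rewrite mulrC.
    by rewrite ler_pM2l// ge_max ltW//= lerB.
move=> /choice[u Hu].
have lagc : - (eps * r%:num) <= c by rewrite /c; lra.
have bc : b < c by rewrite /c ltrDl.
have ux n (s : R) : s <= 0 -> u n s = x s.
  by move=> s0; have [[tau [tau0 _ _ uxn]] _ _ _] := Hu n; apply: uxn; exact: le_trans tau0.
have uL n (s t : R) : 0 <= s -> s <= c -> 0 <= t -> t <= c ->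
    N (u n t - u n s) <= K * `|t - s|.
  have [_ cu ru uM] := Hu n.
  apply: (mean_value_lip hN).
    by apply: cont_on_sub cu; apply: itvcc_sub => //; rewrite oppr_le0.
  move=> w w0 wc; have [w' [w'0 _ w'w rw]] := ru w w0 wc.
  exists (delay_field f eps w' (u n)) => //.
  by apply: (delay_field_le hN eps0 fK w'0 _ cu uM); lra.
have [U [UU oU]] := exists_ultra.
pose A : set R := `[- (eps * r%:num), c]%classic.
have AE s : A s = (- (eps * r%:num) <= s <= c) by rewrite /A /= in_itv.
have : forall s : R, exists l : 'rV[R]_d,
    A s -> forall e, 0 < e -> \forall n \near U, N (u n s - l) < e.
  move=> s; have [As|nAs] := pselect (A s); last by exists 0.
  have [n|l ul] := ultra_lim hN (U := U) (u := fun n => u n s) (M := M + 1); last by exists l.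
  by have [_ _ _ uM] := Hu n; move: As; rewrite AE => /andP[]; exact: uM.
move=> /choice[z uz].
have nU (e : R) : 0 < e -> \forall n \near U, n.+1%:R^-1 < e.
  by move=> e0; apply: oU; exact: near_infty_natSinv_lt (PosNum e0).
have DA : D `<=` A.
  move=> s Ds; rewrite AE (le_trans (Db s Ds) (ltW bc)) andbT.
  by have := Dlag s Ds; rewrite /= in_itv /= andbT.
(* A time below [b] eventually precedes the starting times; if [b] itself lies in [D], every polygon
   starts there. *)
have zx s : D s -> z s = x s.
  move=> Ds; apply/eqP; rewrite -subr_eq0; apply/eqP/(norm_definite hN).
  apply/eqP; rewrite eq_le is_norm_ge0// andbT.
  apply: (@ultra_lim_le _ _ _ hN U _ (fun n => u n s) (fun=> x s)).
  - exact/uz/DA.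
  - by move=> e e0; apply: nearW => n; rewrite subrr is_norm0.
  - have [sb|bs] := ltP s b.
      have : 0 < b - s by rewrite subr_gt0.
      move/nU; apply: filterS => n nbs; have [[tau [_ h1 _ uxn]] _ _ _] := Hu n.
      rewrite uxn ?subrr ?is_norm0//.
      by apply/ltW/(le_lt_trans _ h1); rewrite lerBrDr -lerBrDl ltW.
    have sb : s = b by apply/eqP; rewrite eq_le bs Db.
    apply: nearW => n; have [[tau [_ _ h1 uxn]] _ _ _] := Hu n.
    by rewrite uxn ?subrr ?is_norm0// h1 -?sb.
(* Before 0 all polygons coincide with [x], and after 0 they share the Lipschitz constant [K];
   [split_u] separates the two regimes. *)
have ue s : A s -> forall e, 0 < e -> exists2 rho, 0 < rho &
    forall n s', A s' -> `|s' - s| < rho -> N (u n s' - u n s) < e.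
  rewrite AE => /andP[As1 As2] e e0; have e20 : 0 < e / 2 by lra.
  have Dm : D (Num.min s 0) by apply: D0; rewrite ?ge_min ?lexx ?orbT// le_min As1; lra.
  have [rho rho0 Hr] := cx _ Dm _ e20.
  exists (Num.min rho (e / 2 / K)); first by rewrite lt_min rho0 divr_gt0.
  move=> n s'; rewrite AE lt_min => /andP[As'1 As'2] /andP[h1].
  rewrite ltr_pdivlMr// => h2.
  have Dm' : D (Num.min s' 0) by apply: D0; rewrite ?ge_min ?lexx ?orbT// le_min As'1; lra.
  have split_u w : u n w = x (Num.min w 0) + (u n (Num.max 0 w) - u n 0).
    have [w0|/ltW w0] := leP 0 w; first by rewrite -(ux n 0)// addrC subrK.
    by rewrite subrr addr0 ux.
  have -> : u n s' - u n s = (x (Num.min s' 0) - x (Num.min s 0)) +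
      (u n (Num.max 0 s') - u n (Num.max 0 s)).
    by rewrite (split_u s') (split_u s); apply/rowP => i; rewrite !mxE; ring.
  apply: le_lt_trans (norm_triangle hN _ _) _.
  have h3 := Hr _ Dm' (le_lt_trans (ler_dist_min _ _ _) h1).
  have mx w : w <= c -> 0 <= Num.max 0 w /\ Num.max 0 w <= c.
    by move=> wc; rewrite le_max lexx ge_max wc andbT; split=> //; lra.
  have [m1 m2] := mx _ As2; have [m3 m4] := mx _ As'2.
  have h4 := uL n _ _ m1 m2 m3 m4.
  have h5 : K * `|Num.max 0 s' - Num.max 0 s| <= `|s' - s| * K.
    by rewrite mulrC ler_pM2r// ler_dist_max.
  lra.
have unif := ultra_unif_lim hN (UU := UU) (@segment_compact R _ _) ue uz.
have cz : cont_on N A z.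
  move=> s As e e0; have e20 : 0 < e / 2 by lra.
  have [rho rho0 Hr] := ue s As _ e20; exists rho => // s' As' ss'.
  apply: (@le_lt_trans _ _ (e / 2)); last by lra.
  apply: (ultra_lim_le hN (uz _ As') (uz _ As)).
  by apply: nearW => n; apply/ltW/Hr.
have zL (s t : R) : 0 <= s -> s <= c -> 0 <= t -> t <= c -> N (z t - z s) <= K * `|t - s|.
  move=> h1 h2 h3 h4; apply: (ultra_lim_le hN (uz _ _) (uz _ _)).
  - by rewrite AE h4 andbT; lra.
  - by rewrite AE h2 andbT; lra.
  - by apply: nearW => n; exact: uL.
exists A, z; split=> //.
- split.
  + split.
    * exact: interval_is_interval.
    * by rewrite AE lexx lagc.
    * by move=> s; rewrite AE /= in_itv /= => /andP[->].
    * by exists s1 => //; exact: DA.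
  + exact/(cont_onP hN).
  + move=> th; have /andP[h1 h2] := delay_itv_scale 0 th eps0.
    rewrite zx ?ix//; apply: D0; [move: h1|move: h2]; rewrite !(add0r, sub0r)//.
  + move=> t; rewrite AE => /andP[t1 t2] t0; apply/(has_rateP hN).
    suff H : has_rate N `[0, c] z t (delay_field f eps t z).
      apply: has_rate_sub H => s [] /=; rewrite AE !in_itv /= => /andP[_ ->].
      by move=> /andP[->].
    apply: (secants_has_rate hN zL t0 t2) => eta eta0.
    have te0 : 0 <= t / eps by rewrite divr_ge0// ltW.
    have [kp kp0 Hk] := @hf _ (segment r z t eps) _ te0 eta0.
    have kp20 : 0 < kp / 2 by lra.
    have [rho rho0 Hr] := unif _ kp20.
    (* Closeness of [s'] to [t] is used twice: within [rho] to compare segments, and within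
       [kp * eps] because the time argument of [f] is divided by [eps]. *)
    pose q := Num.min rho (kp * eps).
    have q0 : 0 < q by rewrite lt_min rho0 mulr_gt0.
    have q20 : 0 < q / 2 by lra.
    (* One half of [q] is for the window around [t], the other for the delay of [s'] behind [s], at
       most one Euler step. *)
    have hq : 0 < q / 2 / (2 * sg) by rewrite divr_gt0// mulr_gt0.
    exists (q / 2) => // a' c' a0 ac cc; rewrite !ltr_norml => /andP[ta1 ta2] /andP[tc1 tc2].
    apply: (ultra_lim_secant hN (uz _ _) (uz _ _)).
    * by rewrite AE (ltW cc) andbT; clear -lag0 a0 ac; lra.
    * by rewrite AE; clear -lag0 a0 ac cc; apply/andP; split; lra.
    apply: filterS (filterI Hr (nU _ hq)) => n [/= Hrn].
    rewrite ltr_pdivlMr ?mulr_gt0// [_ * (2 * sg)]mulrC => hn.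
    have [_ cu ru uM] := Hu n.
    apply: (mean_value hN (ltW ac)).
      by apply: cont_on_sub cu; apply: itvcc_sub; [clear -lag0 a0; lra|exact: ltW].
    move=> s as_ sc'.
    have s0 : 0 <= s by exact: le_trans (ltW a0) as_.
    have sc : s < c by exact: lt_trans sc' cc.
    have [s' [s'0 hs' s's rs]] := ru s s0 sc.
    have {}hs' : s - q / 2 < s' by apply: lt_le_trans hs'; rewrite ltrD2l ltrN2.
    exists (delay_field f eps s' (u n)); last first.
      by apply: has_rate_sub rs; apply: itvcc_sub => //; exact: ltW.
    have s't : `|s' - t| < q.
      by rewrite ltr_norml; clear -as_ sc' hs' s's ta1 ta2 tc1 tc2; apply/andP; split; lra.
    apply/ltW/Hk.
    * by rewrite divr_ge0// ltW.
    * rewrite -mulrBl normrM [X in _ * X]gtr0_norm ?invr_gt0// ltr_pdivrMr//.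
      by apply: lt_le_trans s't _; rewrite ge_min lexx orbT.
    * apply: (@le_lt_trans _ _ (kp / 2)); last by clear -kp0; lra.
      apply: supnorm_le => th /=.
      have s'c : s' <= c by exact: le_trans s's (ltW sc).
      rewrite (cont_segmentE hN eps0 s'0 s'c cu) (cont_segmentE hN eps0 t0 t2 cz).
      have /andP[h1 h2] := delay_itv_scale s' th eps0.
      have /andP[h3 h4] := delay_itv_scale t th eps0.
      apply/ltW/Hrn.
      + by rewrite /= in_itv /= (le_trans _ h1) ?(le_trans h2)// lerBrDr addrC subrr.
      + by rewrite /= in_itv /= (le_trans _ h3) ?(le_trans h4)// lerBrDr addrC subrr.
      + rewrite (_ : _ - _ = t - s'); last by ring.
        by rewrite distrC; apply: lt_le_trans s't _; rewrite ge_min lexx.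
- by move=> s /set_mem; exact: zx.
- move=> AD; have : D c by rewrite -AD AE lexx lagc.
  by move/Db; rewrite leNgt bc.
Qed.

Lemma cont_on_bounded (R : realType) d (N : 'rV[R]_d -> R) (hN : is_norm N)
    (x : R -> 'rV[R]_d) (a b : R) : cont_on N `[a, b] x ->
  exists M, forall s, a <= s -> s <= b -> N (x s) <= M.
Proof.
move=> /(cont_onP hN) cx; have [C C0 NC] := is_norm_le_mx_norm hN.
have [K [_ HK]] := compact_bounded (continuous_compact cx (@segment_compact R a b)).
exists (C * (K + 1)) => s as_ sb; apply: le_trans (NC _) _; rewrite ler_pM2l//.
by apply: HK; [rewrite ltrDl|exists s => //=; rewrite in_itv /= as_].
Qed.

Lemma has_rate_coord (R : realType) d (N : 'rV[R]_d -> R) (hN : is_norm N)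
    (D : set R) (x : R -> 'rV[R]_d) (t : R) (v : 'rV[R]_d) :
  (forall i e, 0 < e -> \forall h \near (0 : R),
    `|x (h + t) ord0 i - x t ord0 i - h * v ord0 i| <= e * `|h|) ->
  has_rate N D x t v.
Proof.
move=> H e e0; have [C C0 NC] := is_norm_le_mx_norm hN.
have eC : 0 < e / C by rewrite divr_gt0.
have : \forall h \near (0 : R), forall i,
    `|x (h + t) ord0 i - x t ord0 i - h * v ord0 i| <= e / C * `|h|.
  by apply: (filter_forall (nbhs_filter (0 : R))) => i; exact: H.
move=> /(@nbhs_ballP _ _ (0 : R))[rho /= rho0 Hr].
exists rho => // s _ str; apply: le_trans (NC _) _.
rewrite mulrC -ler_pdivlMr// [leLHS]/Num.norm /= mx_normrE.
have e1 : 0 <= e * `|s - t| / C by rewrite divr_ge0// ?mulr_ge0// ltW.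
apply/bigmax_leP; split => // -[i j] _ /=; rewrite (ord1 i) !mxE.
have := Hr (s - t); rewrite /ball /= sub0r normrN subrK => /(_ str j).
by rewrite mulrAC.
Qed.

(** * Time averages and rescaled primitives of the field at a fixed history *)

Section Averaging.
Context {R : realType} {d : nat} (N : 'rV[R]_d -> R) (hN : is_norm N).
Context {r : {nonneg R}} (f : R -> history d r -> 'rV[R]_d).
Hypothesis hf : continuous_on_Rplus N f.

Definition time_primitive (xi : history d r) (T : R) : 'rV[R]_d :=
  \row_i (\int[lebesgue_measure]_(t in `[0, T]) f t xi ord0 i).

Lemma time_meanE xi T : time_mean f xi T = T^-1 *: time_primitive xi T.
Proof. by apply/rowP => i; rewrite !mxE. Qed.

Lemma cont_time xi : cont_on N `[0, +oo[ (fun t => f t xi).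
Proof.
move=> t; rewrite /= in_itv /= andbT => t0 e e0.
have [kp kp0 Hk] := @hf _ xi _ t0 e0; exists kp => // s.
rewrite /= in_itv /= andbT => s0 st; apply: Hk => //.
apply: le_lt_trans kp0; apply: supnorm_le => th /=.
by rewrite subrr is_norm0.
Qed.

(** Fundamental theorem of calculus in each coordinate. At [u > 0] continuity within the half-line
    of nonnegative times is plain continuity. *)
Lemma time_primitive_rate D xi u : 0 < u -> has_rate N D (time_primitive xi) u (f u xi).
Proof.
move=> u0; apply: (has_rate_coord hN) => i e e0.
pose g t := f t xi ord0 i.
have cg : {within `[0, +oo[, continuous g}.
  have /(cont_onP hN) c1 := @cont_time xi.
  apply/subspace_continuousP => t Dt.
  have ct : (f s xi) @[s --> within `[0, +oo[ (nbhs t)] --> f t xi.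
    by move/subspace_continuousP : c1; exact.
  exact: (continuous_cvg _ (@coord_continuous _ 1 d ord0 i _) ct).
have gu : {for u, continuous g}.
  have /subspace_continuousP/(_ u) := cg.
  rewrite /= in_itv /= andbT => /(_ (ltW u0)); rewrite within_interior//.
  have -> : `[0, +oo[%classic = [set t : R | 0 <= t].
    by apply/seteqP; split => t; rewrite /= in_itv /= andbT.
  apply/nbhs_ballP; exists u => //= t; rewrite /ball /= ltr_norml => /andP[_].
  by rewrite ltrBlDr ltrDl => /ltW.
have u1 : u < u + 1 by rewrite ltrDl.
have ig : lebesgue_measure.-integrable `[0, u + 1] (EFin \o g).
  apply: continuous_compact_integrable; first exact: segment_compact.
  apply: continuous_subspaceW cg => t /=; rewrite !in_itv /= => /andP[->//].
have [dF F'] := continuous_FTC1_closed u1 ig u0 gu.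
set F := fun x0 : R => _ in dF F'.
have /cvgrPdist_le/(_ e e0) : h^-1 *: (F (h + u) - F u) @[h --> 0^'] --> g u.
  rewrite -F' derive1E; move: dF; rewrite /derivable => dF.
  apply: cvg_trans dF; apply: near_eq_cvg; apply: nearW => h /=.
  by rewrite [h *: 1]mulr1.
rewrite /dnbhs near_withinE; apply: filterS => h Hh; rewrite !mxE.
have [->|h0] := eqVneq h 0; first by rewrite add0r subrr mul0r subrr normr0 mulr0.
have {Hh} := Hh h0; rewrite -/(g u) -/(F u) -/(F (h + u)) => Hh.
have -> : F (h + u) - F u - h * g u = h * (h^-1 *: (F (h + u) - F u) - g u).
  by rewrite mulrBr -[_ *: _]/(_ * _) mulVKf.
by rewrite normrM mulrC ler_wpM2r// distrC.
Qed.

(** By substitution the curve is the integral of [f (sigma / eps) xi] for [sigma] in [[0, s]]; in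
    the chain rule the factors [eps] cancel. *)
Lemma rescaled_primitive_rate D xi eps t : 0 < eps -> 0 < t ->
  has_rate N D (fun s => eps *: time_primitive xi (s / eps)) t (f (t / eps) xi).
Proof.
move=> eps0 t0 e e0; have te0 : 0 < t / eps by rewrite divr_gt0.
have [rho rho0 Hr] := @time_primitive_rate setT xi _ te0 _ e0.
exists (rho * eps); first by rewrite mulr_gt0.
move=> s _ str; have := Hr (s / eps) I.
rewrite -mulrBl normrM [X in _ * X]gtr0_norm ?invr_gt0// ltr_pdivrMr// => /(_ str).
rewrite mulrA ler_pdivlMr//; apply: le_trans.
rewrite [leRHS]mulrC -[X in X * N _](gtr0_norm eps0) -(norm_scale hN) le_eqVlt; apply/orP; left.
apply/eqP; congr N; apply/rowP => i; rewrite !mxE; field.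
by rewrite gt_eqF.
Qed.

(** Mean value inequality for [x] minus the rescaled primitive, whose slope is the true field minus
    the field at the fixed history [xi]. Thus [x] is compared with an integral without integrating
    [E]. *)
Lemma rescaled_primitive_secant (x : R -> 'rV[R]_d) (E : R -> 'rV[R]_d) xi eps a c eta :
  0 < eps -> 0 < a -> a <= c -> cont_on N `[a, c] x ->
  (forall s, a <= s -> s < c -> has_rate N `[s, c] x s (E s)) ->
  (forall s, a <= s -> s < c -> N (E s - f (s / eps) xi) <= eta) ->
  N ((x c - eps *: time_primitive xi (c / eps)) -
     (x a - eps *: time_primitive xi (a / eps))) <= eta * (c - a).
Proof.
move=> eps0 a0 ac cx rx xE.
pose p s := eps *: time_primitive xi (s / eps).
have NB (u v : 'rV[R]_d) : N (u - v) <= N u + N v.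
  by rewrite -(is_normN hN v) (norm_triangle hN).
have cp : cont_on N `[a, c] p.
  apply: (has_rate_cont hN) => t; rewrite /= in_itv /= => /andP[at_ _].
  exists (f (t / eps) xi); apply: rescaled_primitive_rate => //.
  exact: lt_le_trans a0 at_.
have := @mean_value _ _ N hN (fun s => x s - p s) a c 0 eta ac.
rewrite scaler0 subr0; apply.
  move=> t tac e e0; have e20 : 0 < e / 2 by rewrite divr_gt0.
  have [rho1 r10 H1] := cx t tac _ e20; have [rho2 r20 H2] := cp t tac _ e20.
  exists (Num.min rho1 rho2); first by rewrite lt_min r10.
  move=> s sac; rewrite lt_min => /andP[s1 s2].
  rewrite (_ : _ - _ = (x s - x t) - (p s - p t)); last first.
    by apply/rowP => i; rewrite !mxE; ring.
  by apply: le_lt_trans (NB _ _) _; rewrite [e]splitr; apply: ltrD; [exact: H1|exact: H2].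
move=> s as_ sc; exists (E s - f (s / eps) xi); first by rewrite subr0; exact: xE.
move=> e e0; have e20 : 0 < e / 2 by rewrite divr_gt0.
have s0 : 0 < s by exact: lt_le_trans a0 as_.
have [rho1 r10 H1] := rx s as_ sc _ e20.
have [rho2 r20 H2] := @rescaled_primitive_rate `[s, c] xi eps s eps0 s0 _ e20.
exists (Num.min rho1 rho2); first by rewrite lt_min r10.
move=> w wD; rewrite lt_min => /andP[w1 w2].
rewrite (_ : _ - _ = (x w - x s - (w - s) *: E s) -
    (p w - p s - (w - s) *: f (s / eps) xi)); last first.
  by apply/rowP => i; rewrite !mxE; ring.
apply: le_trans (NB _ _) _; rewrite [e]splitr mulrDl.
by apply: lerD; [exact: H1|exact: H2].
Qed.

(** The rescaled primitive at [c] equals [c] times the time mean over [[0, c / eps]], and [c / eps]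
    tends to infinity. *)
Lemma rescaled_primitive_lim xi : has_time_means f -> forall c e, 0 < c -> 0 < e ->
  exists2 eps1, 0 < eps1 & forall eps, 0 < eps -> eps < eps1 ->
    N (eps *: time_primitive xi (c / eps) - c *: averaged f xi) < e.
Proof.
move=> H3 c e c0 e0; have /(cvg_is_normP hN) H : time_mean f xi T @[T --> +oo] --> averaged f xi.
  exact: H3.
have [A [_ HA]] := H (e / c) (divr_gt0 e0 c0).
have A0 : 0 < `|A| + 1 by rewrite ltr_wpDl.
exists (c / (`|A| + 1)); first by rewrite divr_gt0.
move=> eps eps0; rewrite ltr_pdivlMr// mulrC -ltr_pdivlMr// => h.
have := HA (c / eps); rewrite time_meanE => /(_ _)/wrap[].
  by apply: le_lt_trans h; rewrite (le_trans (ler_norm A))// lerDl.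
rewrite ltr_pdivlMr// mulrC -[X in X * N _](gtr0_norm c0) -(norm_scale hN).
rewrite scalerBr scalerA invf_div mulrCA divff ?mulr1 ?gt_eqF//.
Qed.

End Averaging.

(** * Exit from the tube around [y] and passage to the averaged equation *)

Lemma delay_solution_history (R : realType) d (r : {nonneg R})
    (f : R -> history d r -> 'rV[R]_d) (phi : history d r) (eps : R) D x t :
  0 < eps -> delay_solution f phi eps D x -> - (eps * r%:num) <= t -> t <= 0 ->
  exists th, x t = phi th.
Proof.
move=> eps0 [_ _ ix _] t1 t2.
have th : t / eps \in (delay_itv r : set R).
  rewrite inE /delay_itv /= in_itv /= ler_pdivlMr// mulNr mulrC t1.
  by rewrite ler_pdivrMr// mul0r.
exists (exist _ (t / eps) th); rewrite -ix; congr x.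
by rewrite /= mulrC divfK// gt_eqF.
Qed.

(** If the distance never reaches [delta], the solution is bounded; stopping short of [L] would then
    contradict maximality by continuation, and reaching [L] contradicts the last hypothesis.
    Otherwise the infimum of the times of distance at least [delta] is the exit time. *)
Lemma maximal_solution_exit (R : realType) d (N : 'rV[R]_d -> R) (hN : is_norm N)
    (r : {nonneg R}) (f : R -> history d r -> 'rV[R]_d) (hf : continuous_on_Rplus N f)
    (H2 : bounded_on_bounded N f) (phi : history d r) (eps : R) (D : set R)
    (x y : R -> 'rV[R]_d) (L delta : R) :
  0 < eps -> maximal_solution (delay_solution f phi eps) D x ->
  (exists M, forall th, N (phi th) <= M) -> 0 <= L -> cont_on N `[0, L] y ->
  ~ (`[- (eps * r%:num), L] `<=` D /\
     (forall t : R, 0 <= t -> t <= L -> N (x t - y t) < delta)) ->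
  exists t : R, [/\ 0 <= t, t <= L, D t, delta <= N (x t - y t) &
    forall s : R, 0 <= s -> s < t -> N (x s - y s) < delta].
Proof.
move=> eps0 [Sx mx] [Mphi hphi] L0 cy nc.
have [[iD Da Dlag [s1 Ds1 s10]] /(cont_onP hN) cx _ _] := Sx.
have lag0 : - (eps * r%:num) <= 0 by rewrite oppr_le0 mulr_ge0// ltW.
have D0 : D 0 by apply: (iD _ _ Da Ds1); rewrite lag0 ltW.
pose S := [set t : R | [/\ 0 <= t, t <= L, D t & delta <= N (x t - y t)]].
have [[t1 St1]|S0] := pselect (S !=set0); last first.
  exfalso; have ND t : 0 <= t -> t <= L -> D t -> N (x t - y t) < delta.
    by move=> t0 tL Dt; rewrite ltNge; apply/negP => h; apply: S0; exists t.
  have [DL|nDL] := pselect (D L).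
    apply: nc; split.
      by move=> s; rewrite /= in_itv /= => h; exact: (iD _ _ Da DL).
    move=> t t0 tL; apply: ND => //; apply: (iD _ _ D0 DL); exact/andP.
  have DleL t : D t -> t <= L.
    move=> Dt; rewrite leNgt; apply/negP => /ltW Lt; apply: nDL.
    by apply: (iD _ _ D0 Dt); rewrite L0.
  have [My hMy] := cont_on_bounded hN cy.
  (* [Mphi] bounds the history and [My + delta] the part inside the tube. *)
  pose M := Num.max Mphi (My + delta).
  have xM t : D t -> N (x t) <= M.
    move=> Dt; rewrite le_max; have [t0|/ltW t0] := leP 0 t; apply/orP.
      right; apply: le_trans (is_norm_sub hN _ (y t)) _; apply: lerD.
        exact: hMy t0 (DleL t Dt).
      by apply/ltW/ND => //; exact: DleL.
    left; have lt : - (eps * r%:num) <= t by have := Dlag _ Dt; rewrite /= in_itv /= andbT.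
    by have [th ->] := delay_solution_history eps0 Sx lt t0.
  have [|K hK] := H2 [set xi | supnorm N xi <= M + 1]; first by exists (M + 1).
  have K0 : 0 < `|K| + 1 by rewrite ltr_wpDl.
  have fK (t : R) (xi : history d r) : 0 <= t -> supnorm N xi <= M + 1 -> N (f t xi) <= `|K| + 1.
    move=> t0 xiM; apply: le_trans (hK t xi t0 xiM) _.
    by apply: le_trans (ler_norm _) _; rewrite lerDl.
  have [D' [x' [Sx' DD' xx' nD]]] := delay_solution_extends hN hf eps0 K0 fK Sx xM
    (ex_intro _ L DleL).
  exact: nD (mx _ _ Sx' DD' xx').
have lS : has_lbound S by exists 0 => t [].
have S0 : 0 <= inf S by apply: lb_le_inf; [exists t1|move=> t []].
have [t10 t1L Dt1 _] := St1.
have SD s : 0 <= s -> s <= t1 -> D s by move=> s0 st; apply: (iD _ _ D0 Dt1); rewrite s0.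
have i1 : inf S <= t1 by exact: ge_inf.
have iL : inf S <= L := le_trans i1 t1L.
exists (inf S); split=> //; first exact: SD.
(* Continuity of [x] and [y] transfers the inequality from nearby points of [S] to its infimum. *)
- apply/ler_addgt0Pr => e e0; have e20 : 0 < e / 2 by rewrite divr_gt0.
  have [rho1 r10 Hx] := cx _ (SD _ S0 i1) _ e20.
  have iI : `[0, L]%classic (inf S) by rewrite /= in_itv /= S0.
  have [rho2 r20 Hy] := cy _ iI _ e20.
  have r0 : 0 < Num.min rho1 rho2 by rewrite lt_min r10.
  have [t St] := inf_adherent r0 (conj (ex_intro _ t1 St1) lS).
  have [t0 tL Dt dt] := St; have it : inf S <= t by exact: ge_inf.
  rewrite -ltrBlDl lt_min => /andP[h1 h2].
  have nt : `|t - inf S| = t - inf S by rewrite ger0_norm// subr_ge0.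
  have h3 := Hx t Dt; rewrite nt in h3; have {}h3 := h3 h1.
  have tI : `[0, L]%classic t by rewrite /= in_itv /= t0.
  have h4 := Hy t tI; rewrite nt in h4; have {}h4 := h4 h2.
  apply: le_trans dt _.
  rewrite (_ : x t - y t = (x (inf S) - y (inf S)) +
    ((x t - x (inf S)) - (y t - y (inf S)))); last first.
    by apply/rowP => i; rewrite !mxE; ring.
  apply: le_trans (norm_triangle hN _ _) _; rewrite lerD2l.
  apply: le_trans (norm_triangle hN _ _) _; rewrite (is_normN hN) [e]splitr.
  by apply/ltW/ltrD.
- move=> s s0 sS; rewrite ltNge; apply/negP => ds.
  suff : inf S <= s by rewrite leNgt sS.
  apply: ge_inf => //; split=> //; first exact: le_trans (ltW sS) iL.
  by apply: SD => //; exact: le_trans (ltW sS) i1.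
Qed.

(** A solution carries a rescaled copy of [phi] on a compact real interval, where its continuity
    gives the bound. *)
Lemma delay_solution_history_bounded (R : realType) d (N : 'rV[R]_d -> R) (hN : is_norm N)
    (r : {nonneg R}) (f : R -> history d r -> 'rV[R]_d) (phi : history d r) (eps : R) D x :
  0 < eps -> delay_solution f phi eps D x -> exists M, forall th, N (phi th) <= M.
Proof.
move=> eps0 [[iD Da _ [s1 Ds1 s10]] /(cont_onP hN) cx ix _].
have sD : `[- (eps * r%:num), 0] `<=` D.
  move=> s; rewrite /= in_itv /= => /andP[h1 h2].
  by apply: (iD _ _ Da Ds1); rewrite h1 (le_trans h2)// ltW.
have [M HM] := cont_on_bounded hN (cont_on_sub sD cx).
exists M => th; rewrite -ix; have := delay_itv_scale 0 th eps0.
by rewrite sub0r add0r => /andP[h1 h2]; exact: HM.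
Qed.

(** The solutions live on intervals of varying length, so each is frozen after [tn n] by [Num.min];
    at times below [T] the freezing eventually disappears. Near [t], a solution minus the rescaled
    primitive for the constant history [z t] has small slope, and in the limit this primitive
    becomes [s *: averaged_field f (z t)], which leaves a secant estimate for [z]. *)
Lemma averaging_limit (R : realType) d (N : 'rV[R]_d -> R) (hN : is_norm N)
    (r : {nonneg R}) (f : R -> history d r -> 'rV[R]_d) (hf : continuous_on_Rplus N f)
    (H1 : continuous_unif_time N f) (H3 : has_time_means f)
    (U : set_system nat) {UU : UltraFilter U} (eps tn : nat -> R) (x : nat -> R -> 'rV[R]_d)
    (z : R -> 'rV[R]_d) (T L K : R) :
  (forall n, 0 < eps n) ->
  (forall e : R, 0 < e -> \forall n \near U, eps n < e) ->
  (forall e : R, 0 < e -> \forall n \near U, `|tn n - T| < e) ->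
  (forall n, 0 <= tn n) -> T <= L ->
  (forall n, cont_on N `[- (eps n * r%:num), tn n] (x n)) ->
  (forall n (s : R), 0 <= s -> s < tn n ->
    has_rate N `[s, tn n] (x n) s (delay_field f (eps n) s (x n))) ->
  (forall n (s t : R), 0 <= s -> s <= tn n -> 0 <= t -> t <= tn n ->
    N (x n t - x n s) <= K * `|t - s|) ->
  (forall s : R, 0 <= s -> s <= L -> forall e : R, 0 < e ->
    \forall n \near U, N (x n (Num.min s (tn n)) - z s) < e) ->
  forall t : R, 0 <= t -> t <= T -> has_rate N `[0, T] z t (averaged_field f (z t)).
Proof.
move=> eps0 epsU tnU tn0 TL cx rx xL xz t t0 tT.
have xhL n s s' : 0 <= s -> 0 <= s' ->
    N (x n (Num.min s' (tn n)) - x n (Num.min s (tn n))) <= `|K| * `|s' - s|.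
  move=> s0 s'0; apply: le_trans (xL n _ _ _ _ _ _) _;
    rewrite ?le_min ?s0 ?s'0 ?tn0 ?ge_min ?lexx ?orbT//.
  apply: le_trans (ler_wpM2r _ (ler_norm K)) _; first by [].
  by rewrite ler_wpM2l// ler_dist_min.
have zL s s' : 0 <= s -> s <= T -> 0 <= s' -> s' <= T -> N (z s' - z s) <= `|K| * `|s' - s|.
  move=> h1 h2 h3 h4.
  apply: (ultra_lim_le hN (xz _ h3 (le_trans h4 TL)) (xz _ h1 (le_trans h2 TL))).
  by apply: nearW => n; exact: xhL.
apply: (secants_has_rate hN zL t0 tT) => eta eta0.
have [kp kp0 Hk] := @H1 (const_history r (z t)) _ eta0.
have K1 : 0 < `|K| + 1 by rewrite ltr_wpDl.
have kp8 : 0 < kp / 8 by rewrite divr_gt0.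
(* Segments will stay within time [2 * q] of [t], so their values move by at most [kp / 4]; with
   [kp / 8] from the convergence at [t] the total is below [kp / 2]. *)
have [q q0 qK] : exists2 q, 0 < q & q * (`|K| + 1) = kp / 8.
  by exists (kp / 8 / (`|K| + 1)); [rewrite divr_gt0|rewrite divfK// gt_eqF].
have r1 : 0 < r%:num + 1 by rewrite ltr_wpDl.
exists q => // a c a0 ac cT ta tc; have c0 : 0 < c := lt_trans a0 ac.
have aT : a < T := lt_trans ac cT.
pose p n s := eps n *: time_primitive f (const_history r (z t)) (s / eps n).
pose G := averaged_field f (z t).
have pU s : 0 < s -> forall e, 0 < e -> \forall n \near U, N (p n s - s *: G) < e.
  move=> s0 e e0; have [e1 e10 He] :=
    rescaled_primitive_lim hN (const_history r (z t)) H3 s0 e0.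
  by apply: filterS (epsU _ e10) => n; exact: He.
have xpU s : 0 < s -> s <= L -> forall e, 0 < e -> \forall n \near U,
    N (x n (Num.min s (tn n)) - p n s - (z s - s *: G)) < e.
  move=> s0 sL e e0; have e20 : 0 < e / 2 by rewrite divr_gt0.
  apply: filterS (filterI (xz _ (ltW s0) sL _ e20) (pU _ s0 _ e20)) => n [/= h1 h2].
  rewrite (_ : _ - _ = (x n (Num.min s (tn n)) - z s) - (p n s - s *: G)); last first.
    by apply/rowP => i; rewrite !mxE; ring.
  by apply: le_lt_trans (norm_triangle hN _ _) _; rewrite (is_normN hN) [e]splitr ltrD.
(* The shape of [ultra_lim_secant] with [w = 0], applied to the solutions minus their rescaled
   primitives. *)
have -> : z c - z a - (c - a) *: G = (z c - c *: G) - (z a - a *: G) - 0.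
  by apply/rowP => i; rewrite !mxE; ring.
have aL : a <= L := ltW (lt_le_trans aT TL).
have cL : c <= L := ltW (lt_le_trans cT TL).
apply: (ultra_lim_secant hN (xpU _ c0 cL) (xpU _ a0 aL)).
(* A lag below [a] hides the initial history from segments at times [s >= a], and a lag below [q]
   keeps them near [t]. The denominator is positive even when [r] is 0. *)
have m0 : 0 < Num.min a q / (r%:num + 1) by rewrite divr_gt0// lt_min a0.
have Tc0 : 0 < T - c by rewrite subr_gt0.
apply: filterS (filterI (filterI (epsU _ m0) (tnU _ Tc0)) (xz _ t0 (le_trans tT TL) _ kp8)).
move=> n [[/= he ht] hz].
have lag : eps n * r%:num < Num.min a q.
  move: he; rewrite ltr_pdivlMr//; apply: le_lt_trans.
  by rewrite ler_pM2l// lerDl.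
move: lag; rewrite lt_min => /andP[lag_a lag_q].
have ctt : c < tn n by clear -ht; move: ht; rewrite ltr_norml => /andP[]; lra.
have att : a < tn n := lt_trans ac ctt.
rewrite subr0 !min_l ?(ltW ctt) ?(ltW att)// /p.
apply: (@rescaled_primitive_secant _ _ _ hN _ _ hf _
  (fun s => delay_field f (eps n) s (x n))) => //.
- exact: ltW.
- apply: cont_on_sub (cx n); apply: itvcc_sub; last exact: ltW.
  by apply: le_trans (ltW a0); rewrite oppr_le0 mulr_ge0// ltW.
- move=> s as_ sc.
  have := rx n s (le_trans (ltW a0) as_) (lt_trans sc ctt).
  by apply: has_rate_sub; apply: itvcc_sub => //; exact: ltW.
move=> s as_ sc; have s0 : 0 <= s := le_trans (ltW a0) as_.
have stt : s <= tn n := ltW (lt_trans sc ctt).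
apply/ltW/Hk; first by rewrite divr_ge0// ltW.
apply: (@le_lt_trans _ _ (kp / 2)); last by rewrite ltr_pdivrMr// ltr_pMr// ltr1n.
apply: supnorm_le => th /=; rewrite (cont_segmentE hN (eps0 n) s0 stt (cx n)).
have /andP[] := delay_itv_scale s th (eps0 n).
move: (s + eps n * _) => w w1 w2.
have w0 : 0 <= w by apply: le_trans w1; rewrite subr_ge0 (le_trans (ltW lag_a)).
have wt : `|w - t| <= 2 * q.
  move: ta tc; rewrite !ltr_norml ler_norml => /andP[ta1 ta2] /andP[tc1 tc2].
  apply/andP; split; first by clear -ta1 w1 as_ lag_q; lra.
  by clear -tc2 w2 sc q0; lra.
have h1 := xhL n t w t0 w0.
rewrite (min_l (le_trans w2 stt)) in h1.
have h2 := is_norm_dist hN (x n (Num.min t (tn n))) (x n w) (z t).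
have h3 : `|K| * `|w - t| <= 2 * (q * (`|K| + 1)).
  rewrite mulrA mulrC; apply: ler_pM => //; last by rewrite lerDl.
rewrite qK in h3; rewrite /const_history /=.
clear -h1 h2 h3 hz kp0; lra.
Qed.

(** * Contradiction with uniqueness for the averaged problem *)

Theorem theorem2p4 (R : realType) (d : nat) (hd : (1 <= d)%N)
    (N : 'rV[R]_d -> R) (hN : is_norm N) (r : {nonneg R})
    (f : R -> history d r -> 'rV[R]_d) (hf : continuous_on_Rplus N f)
    (phi : history d r)
    (H1 : continuous_unif_time N f)
    (H2 : bounded_on_bounded N f)
    (H3 : has_time_means f)
    (H4 : has_unique_solution
            (ode_solution (averaged_field f) (phi (now r))))
    (J : set R) (y : R -> 'rV[R]_d)
    (hy : maximal_solution
            (ode_solution (averaged_field f) (phi (now r))) J y)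
    (L : R) (hL : J L) :
  forall delta : R, 0 < delta ->
  exists2 eps0 : R, 0 < eps0 &
    forall eps : R, 0 < eps -> eps <= eps0 ->
    forall (D : set R) (x : R -> 'rV[R]_d),
      maximal_solution (delay_solution f phi eps) D x ->
      `[- (eps * r%:num), L] `<=` D /\
      (forall t : R, 0 <= t -> t <= L -> N (x t - y t) < delta).
Proof.
move=> delta delta0; apply: contrapT => Hno.
have [[[iJ J0 Jge _] /(cont_onP hN) cyJ y0 _] _] := hy.
rewrite oppr0 in J0 Jge.
have L0 : 0 <= L by have := Jge _ hL; rewrite /= in_itv /= andbT.
have cy : cont_on N `[0, L] y.
  apply: cont_on_sub cyJ => s; rewrite /= in_itv /= => h; exact: (iJ _ _ J0 hL).
have bad (n : nat) : exists p : R * (set R * (R -> 'rV[R]_d)),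
    [/\ 0 < p.1, p.1 <= n.+1%:R^-1, maximal_solution (delay_solution f phi p.1) p.2.1 p.2.2 &
    ~ (`[- (p.1 * r%:num), L] `<=` p.2.1 /\
      (forall t : R, 0 <= t -> t <= L -> N (p.2.2 t - y t) < delta))].
  apply: contrapT => Hn; apply: Hno; exists n.+1%:R^-1 => // eps e0 en D x Sx.
  by apply: contrapT => nc; apply: Hn; exists (eps, (D, x)).
(* Any of the bad solutions provides a bound for [phi]. *)
have [M1 hM1] : exists M, forall th, N (phi th) <= M.
  have [[eps [D x]] [/= e0 _ [Sx _] _]] := bad 0%N.
  exact: (delay_solution_history_bounded hN e0 Sx).
have [My hMy] := cont_on_bounded hN cy.
pose M := Num.max M1 (My + delta).
have [|K0 hK0] := H2 [set xi | supnorm N xi <= M]; first by exists M.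
pose K : R := `|K0| + 1.
have Kp : 0 < K by rewrite ltr_wpDl.
have fK (t : R) (xi : history d r) : 0 <= t -> supnorm N xi <= M -> N (f t xi) <= K.
  move=> t0 xiM; apply: le_trans (hK0 t xi t0 xiM) _.
  by apply: le_trans (ler_norm _) _; rewrite lerDl.
have : forall n : nat, exists p : (R * R) * (R -> 'rV[R]_d), let: (eps, tn, x) := p in
  [/\ [/\ 0 < eps, eps <= n.+1%:R^-1, 0 <= tn & tn <= L],
      [/\ cont_on N `[- (eps * r%:num), tn] x, x 0 = phi (now r) &
        forall s, - (eps * r%:num) <= s -> s < tn -> N (x s) <= M],
      forall s, 0 <= s -> s < tn -> has_rate N `[s, tn] x s (delay_field f eps s x) &
      delta <= N (x tn - y tn)].
  move=> n; have [[eps [D x]] [/= e0 en mx nc]] := bad n.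
  have [tn [tn0 tnL Dtt dtt xy]] :=
    maximal_solution_exit hN hf H2 e0 mx (ex_intro _ M1 hM1) L0 cy nc.
  have [[[iD Da _ _] /(cont_onP hN) cx ix rx] _] := mx.
  have sD : `[- (eps * r%:num), tn] `<=` D.
    by move=> s; rewrite /= in_itv /= => h; exact: (iD _ _ Da Dtt).
  exists ((eps, tn), x); split=> //.
  - split; first exact: cont_on_sub cx.
      by rewrite -(ix (now r)) /= mulr0.
    move=> s s1 st; rewrite /M le_max; apply/orP; have [s0|/ltW s0] := leP 0 s.
      right; apply: le_trans (is_norm_sub hN _ (y s)) _.
      apply: lerD; first by apply: hMy => //; exact: le_trans (ltW st) tnL.
      exact/ltW/xy.
    by left; have [th ->] := delay_solution_history e0 (proj1 mx) s1 s0.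
  - move=> s s0 st.
    have Ds : D s.
      apply: sD; rewrite /= in_itv /= (ltW st) andbT (le_trans _ s0)//.
      by rewrite oppr_le0 mulr_ge0// ltW.
    apply: has_rate_sub (proj1 (has_rateP hN _ _ _ _) (rx s Ds s0)) => w /=.
    rewrite !in_itv /= andbT => /andP[sw wt]; split; last exact: le_trans sw.
    by apply: (iD _ _ Ds Dtt); rewrite sw.
move=> /choice[p Hp].
pose eps n := (p n).1.1; pose tn n := (p n).1.2; pose x n := (p n).2.
have {}Hp n : [/\ [/\ 0 < eps n, eps n <= n.+1%:R^-1, 0 <= tn n & tn n <= L],
      [/\ cont_on N `[- (eps n * r%:num), tn n] (x n), x n 0 = phi (now r) &
        forall s, - (eps n * r%:num) <= s -> s < tn n -> N (x n s) <= M],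
      forall s, 0 <= s -> s < tn n ->
        has_rate N `[s, tn n] (x n) s (delay_field f (eps n) s (x n)) &
      delta <= N (x n (tn n) - y (tn n))].
  by have := Hp n; rewrite /eps /tn /x; case: (p n) => [[? ?] ?].
have eps0 n : 0 < eps n by have [[]] := Hp n.
have tn0 n : 0 <= tn n by have [[]] := Hp n.
have tnL n : tn n <= L by have [[]] := Hp n.
have lag0 n : - (eps n * r%:num) <= 0 by rewrite oppr_le0 mulr_ge0// ltW.
(* The bound [M] is known only before the exit time, which suffices: the slopes used are those at
   [w < tn n], and they depend on times up to [w]. *)
have xL n (s t : R) : 0 <= s -> s <= tn n -> 0 <= t -> t <= tn n ->
    N (x n t - x n s) <= K * `|t - s|.
  have [_ [cx _ xM] rx _] := Hp n; apply: (mean_value_lip hN).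
    by apply: cont_on_sub cx; exact: itvcc_sub.
  move=> w w0 wt; exists (delay_field f (eps n) w (x n)); last exact: rx.
  apply: fK; first by rewrite divr_ge0// ltW.
  apply: supnorm_le => th; rewrite (cont_segmentE hN (eps0 n) w0 (ltW wt) cx).
  have /andP[h1 h2] := delay_itv_scale w th (eps0 n).
  apply: xM; last exact: le_lt_trans wt.
  by apply: le_trans h1; rewrite lerBrDr addrC subrr.
have [U [UU oU]] := exists_ultra.
have epsU (e : R) : 0 < e -> \forall n \near U, eps n < e.
  move=> e0; have : \forall n \near U, n.+1%:R^-1 < e.
    by apply: oU; exact: near_infty_natSinv_lt (PosNum e0).
  by apply: filterS => n; have [[_ h _ _] _ _ _] := Hp n; exact: le_lt_trans.
have [T /andP[T0 TL] tnU] : exists2 T, 0 <= T <= L &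
    forall e, 0 < e -> \forall n \near U, `|tn n - T| < e.
  by apply: ultra_lim_real => n; rewrite tn0 tnL.
have : forall s : R, exists l : 'rV[R]_d, 0 <= s -> s <= L -> forall e, 0 < e ->
    \forall n \near U, N (x n (Num.min s (tn n)) - l) < e.
  (* For negative [s] the value 0 is a dummy. *)
  move=> s; have [s0|s0] := leP 0 s; last by exists 0.
  have [n|l xl] := ultra_lim hN (U := U) (u := fun n => x n (Num.min s (tn n)))
    (M := N (phi (now r)) + K * L); last by exists l.
  have [_ [_ <- _] _ _] := Hp n; apply: le_trans (is_norm_sub hN _ (x n 0)) _.
  rewrite lerD2l; apply: le_trans (xL n _ _ _ _ _ _) _;
    rewrite ?le_min ?s0 ?tn0 ?ge_min ?lexx ?orbT//.
  have m0 : 0 <= Num.min s (tn n) by rewrite le_min s0 tn0.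
  by rewrite subr0 ger0_norm// ler_pM2l// ge_min tnL orbT.
move=> /choice[z xz].
have z0 : z 0 = phi (now r).
  apply/eqP; rewrite -subr_eq0; apply/eqP/(norm_definite hN).
  apply/eqP; rewrite eq_le is_norm_ge0// andbT.
  apply: (ultra_lim_le hN (v := fun=> phi (now r)) (xz 0 (lexx _) L0)).
    by move=> e e0; apply: nearW => n; rewrite subrr is_norm0.
  by apply: nearW => n; rewrite min_l//; have [_ [_ -> _] _ _] := Hp n; rewrite subrr is_norm0.
(* The exit inequality at [tn n] survives in the limit: [y] is continuous at [T], and the common
   Lipschitz constant controls [x n] between [Num.min T (tn n)] and [tn n]. *)
have yT : delta <= N (z T - y T).
  apply/ler_addgt0Pr => e e0; have e40 : 0 < e / 4 by rewrite divr_gt0.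
  have TI : `[0, L]%classic T by rewrite /= in_itv /= T0.
  have [rho rho0 Hy] := cy T TI _ e40.
  have q0 : 0 < Num.min rho (e / 4 / K) by rewrite lt_min rho0 divr_gt0.
  have [n [/= h1 h2]] := filter_ex (filterI (tnU _ q0) (xz T T0 TL _ e40)).
  move: h1; rewrite lt_min => /andP[h1]; rewrite ltr_pdivlMr// mulrC => h3.
  have [_ _ _ dn] := Hp n.
  have h4 : N (y (tn n) - y T) < e / 4 by apply: Hy; rewrite //= in_itv /= tn0 tnL.
  have h5 : N (x n (tn n) - x n (Num.min T (tn n))) <= K * `|tn n - T|.
    apply: le_trans (xL n _ _ _ _ _ _) _; rewrite ?le_min ?T0 ?tn0 ?ge_min ?lexx ?orbT//.
    by rewrite ler_pM2l// -{1}(minxx (tn n)) ler_dist_min.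
  apply: le_trans dn _.
  rewrite (_ : x n (tn n) - y (tn n) = (z T - y T) + ((x n (Num.min T (tn n)) - z T) +
     ((x n (tn n) - x n (Num.min T (tn n))) - (y (tn n) - y T)))); last first.
    by apply/rowP => i; rewrite !mxE; ring.
  apply: le_trans (norm_triangle hN _ _) _; rewrite lerD2l.
  apply: le_trans (norm_triangle hN _ _) _.
  apply: le_trans (lerD (lexx _) (norm_triangle hN _ _)) _; rewrite (is_normN hN).
  by clear -h2 h3 h4 h5 e0; lra.
(* At time 0 both curves equal [phi (now r)], so the gap [delta] excludes [T = 0]; the domain of a
   solution must reach beyond 0. *)
have Tpos : 0 < T.
  rewrite lt_neqAle T0 andbT; apply/eqP => TE; move: yT.
  by rewrite -TE z0 y0 subrr is_norm0// leNgt delta0.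
have rz t : 0 <= t -> t <= T -> has_rate N `[0, T] z t (averaged_field f (z t)).
  apply: (@averaging_limit _ _ _ hN _ _ hf H1 H3 U UU eps tn x z T L K) => //.
  - by move=> n; have [_ []] := Hp n.
  - by move=> n s; have [_ _ rx _] := Hp n; exact: rx.
have Sz : ode_solution (averaged_field f) (phi (now r)) `[0, T] z.
  split=> //.
  - split; first exact: interval_is_interval.
    + by rewrite oppr0 /= in_itv /= lexx.
    + by move=> s; rewrite oppr0 /= !in_itv /= => /andP[->].
    + by exists T => //; rewrite /= in_itv /= T0 lexx.
  - apply/(cont_onP hN)/(has_rate_cont hN) => t; rewrite /= in_itv /= => /andP[h1 h2].
    by exists (averaged_field f (z t)); exact: rz.
  - move=> t; rewrite /= in_itv /= => /andP[h1 h2] _; apply/(has_rateP hN).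
    by apply: has_rate_sub (rz t h1 h2) => s [].
(* On [[0, T]] the curve [z] need not be maximal, so the clause of [H4] on arbitrary solutions is
   taken; it identifies both [y] and [z] with [w]. *)
have [D0 [w [_ _ uniq_w]]] := H4.
have [JD0 yw] := uniq_w _ _ (proj1 hy); have [_ zw] := uniq_w _ _ Sz.
have JT : J T by apply: (iJ _ _ J0 hL); rewrite T0.
have zT : z T = w T by apply: zw; rewrite inE /= in_itv /= T0 lexx.
move: yT; rewrite zT -(yw T); last by rewrite inE.
by rewrite subrr is_norm0// leNgt delta0.
Qed.
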